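(* Fix $1<p<\infty$. For every $0<c\le1$ the three properties $\mathrm{LEP}_p$, $\mathrm{CAS}_{p,c}$ and $\mathrm{DCP}_{p,c}$ are equivalent: $$\mathrm{LEP}_p\iff\mathrm{CAS}_{p,c}\iff\mathrm{DCP}_{p,c}.$$ More precisely, $\mathrm{LEP}_p$ implies $\mathrm{CAS}_{p,c}$ for every $c\in(0,1]$, while $\mathrm{CAS}_{p,c}$ for some $c\in(0,1]$ already implies $\mathrm{LEP}_p$.
   Context: A Dirichlet polynomial is a finite sum $P(s)=\sum_{n\in\mathcal F}a_n n^{-s}$, $\mathcal F\subset\mathbb N$ finite. With $n=\prod_r r^{\nu_r(n)}$ (over primes), its Bohr lift is $\mathcal BP(z)=\sum_{n}a_n\prod_r z_r^{\nu_r(n)}$ and $\|P\|_{\mathcal H^p}^p=\int|\mathcal BP|^p\,dm$, the integral over the finite-dimensional torus in the variables $z_r$, $r\le y$, with normalized Haar measure, where $y$ is large enough to contain all primes dividing some $n\in\mathcal F$. $\mathrm{LEP}_p$: there is $C_p<\infty$ such that $\sup_{\theta\in\mathbb R}\int_\theta^{\theta+1}|P(\frac12+it)|^p\,dt\le C_p\|P\|_{\mathcal H^p}^p$ for every Dirichlet polynomial $P$. For an integer $X\ge3$ put $L_X=\log X$ and let $\mathcal P_X$ be the space of Dirichlet polynomials $P(s)=\sum_{1\le n<X}a_nn^{-s}$. For $0<c\le1$, a pair $(X,\mathcal T)$ is admissible if $X\ge3$ is an integer and $\mathcal T$ is a finite subset of some interval $I\subset\mathbb R$ of length one such that $|\tau-\sigma|\ge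 c/L_X$ for all distinct $\tau,\sigma\in\mathcal T$. $\mathrm{CAS}_{p,c}$: there is $A_{p,c}<\infty$ such that for every admissible pair $(X,\mathcal T)$ and every $P\in\mathcal P_X$, $$\Bigl(\frac1{L_X}\sum_{\tau\in\mathcal T}|P(\tfrac12+i\tau)|^p\Bigr)^{1/p}\le A_{p,c}\|P\|_{\mathcal H^p}.$$ $\mathrm{DCP}_{p,c}$: with $p'=p/(p-1)$, there is $B_{p,c}<\infty$ such that for every admissible pair $(X,\mathcal T)$ and every complex vector $(b_\tau)_{\tau\in\mathcal T}$, $$\sup_{P\in\mathcal P_X,\ \|P\|_{\mathcal H^p}\le1}\Bigl|L_X^{-1/p}\sum_{\tau\in\mathcal T}b_\tau P(\tfrac12+i\tau)\Bigr|\le B_{p,c}\Bigl(\sum_{\tau\in\mathcal T}|b_\tau|^{p'}\Bigr)^{1/p'}.$$ *)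

(* Defs.v *)
From HB Require Import structures.
From mathcomp Require Import all_boot all_order all_algebra.
From mathcomp Require Import finmap.
From mathcomp Require Import all_classical all_reals all_analysis.
From mathcomp Require Import complex.

Set Implicit Arguments.
Unset Strict Implicit.
Unset Printing Implicit Defensive.

Import Order.TTheory GRing.Theory Num.Theory.
Import numFieldNormedType.Exports.

Local Open Scope classical_set_scope.
Local Open Scope ring_scope.

(* The norm of R[i] takes its values in R[i]; normc is the modulus with values
   in R. *)
Notation normc := complex.ComplexField.Normc.normc.

Section product_probability_on_tuples.
Context {d : measure_display} {T : measurableType d} {R : realType}.

Definition pair_tuple n (x : T * n.-tuple T) : n.+1.-tuple T :=
  [tuple of x.1 :: x.2].

Lemma measurable_pair_tuple n : measurable_fun setT (@pair_tuple n).
Proof. exact: measurable_cons. Qed.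

HB.instance Definition _ n :=
  isMeasurableFun.Build _ _ _ _ (@pair_tuple n) (@measurable_pair_tuple n).

Fixpoint tuple_prob (P : probability T R) n : probability (n.-tuple T) R :=
  if n is m.+1
  then distribution (P \x tuple_prob P m)%E (@pair_tuple m)
  else \d_([tuple]).

End product_probability_on_tuples.

Section dirichlet_polynomials.
Context {R : realType}.
Implicit Types (p c t : R) (s : R[i]).

Definition cexp s : R[i] :=
  Complex (expR (complex.Re s) * cos (complex.Im s))
          (expR (complex.Re s) * sin (complex.Im s)).

(* The values of dcoef outside dsupp are irrelevant. *)
Record dirichlet_poly := DirichletPoly {
  dsupp : {fset nat} ;
  dcoef : nat -> R[i] ;
  dsupp_pos : 0%N \notin dsupp
}.
Implicit Type P : dirichlet_poly.

(* n^-s is exp (- s log n). *)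
Definition deval P s : R[i] :=
  \sum_(n <- dsupp P) dcoef P n * cexp (- s * Complex (ln n%:R) 0).

Definition critical t : R[i] := Complex 2^-1 t.

(* The variables z are indexed by nat, but only prime indices occur. *)
Definition bohr_lift P (z : nat -> R[i]) : R[i] :=
  \sum_(n <- dsupp P) dcoef P n * \prod_(r <- primes n) z r ^+ logn r n.

Definition primes_upto (y : nat) : seq nat := [seq r <- iota 0 y.+1 | prime r].

(* The torus is parametrised by angles: z_r = exp (2 i pi theta_r) for r prime,
   r <= y, with theta distributed uniformly in the unit cube. The law of z is
   then the normalized Haar measure. *)
Definition haar_angles (y : nat) :
    probability ((size (primes_upto y)).-tuple (measurableTypeR R)) R :=
  tuple_prob (uniform_prob (@ltr01 R)) (size (primes_upto y)).

Definition torus_point (y : nat) (theta : (size (primes_upto y)).-tuple R)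
    (r : nat) : R[i] :=
  cexp (Complex 0 (2 * pi * nth 0 theta (index r (primes_upto y)))).

Definition hardy_norm_at (y : nat) p P : \bar R :=
  ('N[haar_angles y]_(p%:E) [(fun theta =>
     (normc (bohr_lift P (torus_point theta)))%:E)])%E.

(* The choice of y is immaterial as soon as no prime factor of an element of
   dsupp P exceeds y; the largest element of dsupp P is such a bound. *)
Definition hardy_norm p P : \bar R :=
  hardy_norm_at (\max_(n <- dsupp P) n) p P.

Definition LEP p : Prop :=
  exists C : R, forall P,
    (ereal_sup (range (fun theta : R =>
       \int[lebesgue_measure]_(t in `[theta, (theta + 1)%R])
         (normc (deval P (critical t)) `^ p)%:E))
     <= C%:E * hardy_norm p P `^ p)%E.

Definition logX (X : nat) : R := ln X%:R.

Definition dirichlet_upto (X : nat) : set dirichlet_poly :=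
  [set P | forall n, n \in dsupp P -> (1 <= n < X)%N].

(* A subset of an interval of length one, whether open, half-open or closed,
   lies in a closed one. *)
Definition admissible c (X : nat) (T : {fset R}) : Prop :=
  [/\ (3 <= X)%N,
      exists a : R, forall t, t \in T -> a <= t <= a + 1 &
      forall t u, t \in T -> u \in T -> t != u -> c / logX X <= `|t - u|].

Definition CAS p c : Prop :=
  exists A : R, forall X T, admissible c X T ->
    forall P, dirichlet_upto X P ->
    ((((logX X)^-1 * \sum_(t <- T) normc (deval P (critical t)) `^ p)
        `^ p^-1)%:E
     <= A%:E * hardy_norm p P)%E.

Definition DCP p c : Prop :=
  let p' := p / (p - 1) in
  exists B : R, forall X T, admissible c X T ->
    forall b : R -> R[i],
    (ereal_sup
       [set (normc (Complex (logX X `^ (- p^-1)) 0 *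
                    \sum_(t <- T) b t * deval P (critical t)))%:E
        | P in dirichlet_upto X `&` [set P | hardy_norm p P <= 1]]
     <= (B * (\sum_(t <- T) normc (b t) `^ p') `^ p'^-1)%:E)%E.

End dirichlet_polynomials.

(* Main.v *)
Require Import Defs.
From mathcomp Require Import all_boot all_order all_algebra.
From mathcomp Require Import finmap.
From mathcomp Require Import all_classical all_reals all_analysis.
From mathcomp Require Import measurable_realfun complex ring lra zify.

Set Implicit Arguments.
Unset Strict Implicit.
Unset Printing Implicit Defensive.

Import Order.TTheory GRing.Theory Num.Theory.
Import numFieldNormedType.Exports.

Local Open Scope classical_set_scope.
Local Open Scope ring_scope.

(** Throughout, [cval P t] is the modulus of [P] at [1/2 + it] and [hpnorm p P]
    is the H^p norm as a real number.

    Why local embedding implies sampling. Let [T] be separated by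
    [2 delta = c / log X] and let [P] have length [X], so that its frequencies
    [ln n] satisfy [delta ln n <= 1/2]. Averaging over the window
    [[t - delta, t + delta]] multiplies the wave of frequency [l] by
    sinc (delta l), where sinc x = sin x / x. Hence [P t] is exactly the window
    average at [t] of the polynomial [Q] whose coefficients are those of [P]
    divided by sinc (delta ln n), and by Jensen
    [2 delta |P t|^p <= \int |Q|^p] over the window
    ([cval_powR_le_integral]). The windows are disjoint and lie within three
    intervals of length one, so the local embedding applied to [Q] bounds the
    sum by a multiple of the p-th power of the norm of [Q].

    It remains to see that passing from [P] to [Q] is bounded on H^p,
    uniformly in [X] ([hpnorm_inv_sinc]). With [y = sin x], the arcsine series
    gives
      [x / sin x = \sum_j asin_coef j * (sin x) ^ (2 j)],
    with nonnegative coefficients of sum at most two. The multiplier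
    [sin (delta ln n)] is half a difference of the twists
    [a n |-> a n * n ^ (+- i delta)], up to a unimodular factor; a twist rotates
    the variables of the Bohr lift and so preserves the H^p norm, Haar measure
    being invariant ([hpnorm_rot]). So every power of the multiplier is a
    contraction, and the series has norm at most two.

    Why sampling implies local embedding. Cut an interval of length one into
    [N] equal pieces, with [N] the integer part of [log X / c]. The integral over
    the interval is the integral, over one piece, of the sum over the [N]
    translates of a point; these translates are separated by [1 / N], which is
    at least [c / log X], so sampling bounds every such sum ([CAS_LEP]).

    The discrete dual property is the sampling property read through the
    duality of l^p and l^p' ([CAS_DCP], [DCP_CAS]). *)

(** * Complex exponentials and moduli *)

Section complex_modulus.
Context {R : realType}.
Implicit Types (z w u : R[i]) (x y : R).

Lemma cReD z w : complex.Re (z + w) = complex.Re z + complex.Re w.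
Proof. by case: z w => [a b] [c d]. Qed.

Lemma cImD z w : complex.Im (z + w) = complex.Im z + complex.Im w.
Proof. by case: z w => [a b] [c d]. Qed.

Lemma cReM z w : complex.Re (z * w) =
  complex.Re z * complex.Re w - complex.Im z * complex.Im w.
Proof. by case: z w => [a b] [c d]. Qed.

Lemma cImM z w : complex.Im (z * w) =
  complex.Re z * complex.Im w + complex.Im z * complex.Re w.
Proof. by case: z w => [a b] [c d]. Qed.

Lemma Re_sum (I : Type) (s : seq I) (F : I -> R[i]) :
  complex.Re (\sum_(i <- s) F i) = \sum_(i <- s) complex.Re (F i).
Proof. by elim/big_ind2: _ => // z x w y <- <-; rewrite cReD. Qed.

Lemma normcM z w : normc (z * w) = normc z * normc w.
Proof. exact: complex.ComplexField.Normc.normcM. Qed.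

Lemma normc_sqrtE z : normc z = Num.sqrt (complex.Re z ^+ 2 + complex.Im z ^+ 2).
Proof. by case: z. Qed.

Lemma normc_ge0 z : 0 <= normc z.
Proof. by rewrite normc_sqrtE sqrtr_ge0. Qed.

Lemma normc_sum (I : Type) (s : seq I) (F : I -> R[i]) :
  normc (\sum_(i <- s) F i) <= \sum_(i <- s) normc (F i).
Proof.
elim/big_ind2: _ => [|z x w y zx wy|//].
  by rewrite complex.ComplexField.Normc.normc0.
by rewrite (le_trans (le_normcD _ _))// lerD.
Qed.

Lemma Re_le_normc z : complex.Re z <= normc z.
Proof.
rewrite normc_sqrtE (le_trans (ler_norm _))// -sqrtr_sqr ler_wsqrtr//.
by rewrite lerDl sqr_ge0.
Qed.

Lemma normc_real x : normc (Complex x 0) = `|x|.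
Proof. by rewrite normc_sqrtE /= expr0n addr0 sqrtr_sqr. Qed.

(** Rotating a complex number onto the positive half-line turns its modulus into
    a real part, which commutes with integration. *)
Lemma normc_phase z : exists2 u, normc u = 1 & complex.Re (u * z) = normc z.
Proof.
have [z0|z0] := eqVneq (normc z) 0.
  exists 1; first exact: complex.ComplexField.Normc.normc1.
  by rewrite mul1r (complex.ComplexField.Normc.eq0_normc z0)
    complex.ComplexField.Normc.normc0.
have zz : complex.Re z ^+ 2 + complex.Im z ^+ 2 = normc z ^+ 2.
  by rewrite normc_sqrtE sqr_sqrtr// addr_ge0 ?sqr_ge0.
exists (Complex (complex.Re z / normc z) (- (complex.Im z / normc z))).
  rewrite normc_sqrtE /= sqrrN !expr_div_n -mulrDl zz divff ?sqrtr1//.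
  by rewrite sqrf_eq0.
rewrite cReM /= mulNr opprK -2!(mulrAC _ _ (normc z)^-1) -mulrDl -!expr2 zz.
by rewrite expr2 mulfK.
Qed.

Lemma cexpD z w : cexp (z + w) = cexp z * cexp w.
Proof.
case: z w => [a b] [c d]; rewrite /cexp /= expRD cosD sinD.
by apply/eqP; rewrite eq_complex /=; apply/andP; split; apply/eqP; ring.
Qed.

Lemma cexp0 : cexp (0 : R[i]) = 1.
Proof. by rewrite /cexp /= expR0 cos0 sin0 mulr0 mulr1. Qed.

Lemma normc_cexp z : normc (cexp z) = expR (complex.Re z).
Proof.
rewrite normc_sqrtE /= !exprMn -mulrDr cos2Dsin2 mulr1 sqrtr_sqr ger0_norm//.
Qed.

Definition cis x : R[i] := cexp (Complex 0 x).

Lemma cisE x : cis x = Complex (cos x) (sin x).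
Proof. by rewrite /cis /cexp /= expR0 !mul1r. Qed.

Lemma cisD x y : cis (x + y) = cis x * cis y.
Proof.
by rewrite /cis -cexpD; congr cexp; apply/eqP; rewrite eq_complex/= addr0 !eqxx.
Qed.

Lemma cis0 : cis 0 = 1. Proof. exact: cexp0. Qed.

Lemma cisMn x n : cis x ^+ n = cis (x *+ n).
Proof.
by elim: n => [|n ih]; rewrite ?mulr0n ?cis0// exprS ih mulrS cisD.
Qed.

Lemma normc_cis x : normc (cis x) = 1.
Proof. by rewrite normc_cexp expR0. Qed.

Lemma sin_cis x : Complex (sin x) 0 =
  Complex 0 (- 2^-1) * cis x + Complex 0 2^-1 * cis (- x).
Proof.
rewrite !cisE sinN cosN.
by apply/eqP; rewrite eq_complex /=; apply/andP; split; apply/eqP; field.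
Qed.

End complex_modulus.

(** * Invariance of Haar measure under rotations *)

Section rotation_of_the_circle.
Context {R : realType}.
Local Notation mu := (@lebesgue_measure R).

(** Translation preserves the length of intervals, which determines the
    measure. *)
Lemma lebesgue_measure_shift (s : R) (A : set R) : measurable A ->
  pushforward mu (fun x : measurableTypeR R => x + s : measurableTypeR R) A
  = mu A.
Proof.
move=> mA.
have mS : measurable_fun setT (fun x : measurableTypeR R => x + s).
  exact: measurable_funD.
apply/esym/(@lebesgue_measure_unique R (pushforward mu
  (fun x : measurableTypeR R => x + s : measurableTypeR R))) => //.
move=> _ [[a b]] _ <-; rewrite /pushforward.
rewrite [X in _ = mu X](_ : _ = `]a - s, b - s]%classic); last first.
  by apply/seteqP; split => x /=; rewrite !in_itv/= ltrBlDr lerBrDr.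
by rewrite !lebesgue_measure_itv/= !lte_fin ltrD2r -!EFinB; case: ifP => // _;
  congr EFin; ring.
Qed.

Lemma ge0_integral_shift (s : R) (D : set R) (f : R -> \bar R) :
  measurable D -> measurable_fun setT f -> (forall x, 0 <= f x)%E ->
  (\int[mu]_(x in [set x | D (x + s)%R]) f (x + s)%R = \int[mu]_(x in D) f x)%E.
Proof.
move=> mD mf f0.
pose S (x : measurableTypeR R) : measurableTypeR R := x + s.
have mS : measurable_fun setT S by exact: measurable_funD.
have E := @ge0_integral_pushforward _ _ _ (measurableTypeR R) R S mS mu D f mD
  (measurable_funTS mf) (fun y _ => f0 y).
rewrite -[LHS]E; apply: eq_measure_integral => //= A mA _.
exact: lebesgue_measure_shift.
Qed.

Lemma ge0_integral_split (a c b : R) (g : R -> \bar R) :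
  measurable_fun setT g -> (forall x, 0 <= g x)%E -> a <= c -> c <= b ->
  (\int[mu]_(x in `[a, b]) g x =
   \int[mu]_(x in `[a, c[) g x + \int[mu]_(x in `[c, b[) g x)%E.
Proof.
move=> mg g0 ac cb.
rewrite -integral_itv_bndo_bndc; last exact: measurable_funTS.
rewrite -(ge0_integral_setU) //.
- by rewrite -itv_bndbnd_setU// bnd_simp.
- exact: measurable_funTS.
- apply/disj_setPS => x /= []; rewrite !in_itv/= => /andP[_ xc] /andP[cx _].
  by move: (lt_le_trans xc cx); rewrite ltxx.
Qed.

Lemma ge0_integral_split_closed (a c b : R) (g : R -> \bar R) :
  measurable_fun setT g -> (forall x, 0 <= g x)%E -> a <= c -> c <= b ->
  (\int[mu]_(x in `[a, b]) g x =
   \int[mu]_(x in `[a, c]) g x + \int[mu]_(x in `[c, b]) g x)%E.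
Proof.
move=> mg g0 ac cb; rewrite (ge0_integral_split mg g0 ac cb).
by rewrite !integral_itv_bndo_bndc//; exact: measurable_funTS.
Qed.

(** The rotation of the circle by the angle [s], read on the fundamental domain
    [[0, 1[] of the uniform measure; [s] is meant to lie in [[0, 1]]. *)
Definition circle_rot (s x : R) : R := if x + s < 1 then x + s else x + s - 1.

Lemma measurable_circle_rot s : measurable_fun setT (circle_rot s).
Proof.
apply: measurable_fun_ifT => //.
- by apply: measurable_fun_ltr => //; exact: measurable_funD.
- exact: measurable_funD.
- by apply: measurable_funB => //; exact: measurable_funD.
Qed.

(** The rotation translates [[0, 1 - s[] onto [[s, 1[] and [[1 - s, 1[] onto
    [[0, s[]. *)
Lemma ge0_integral_circle_rot (s : R) (f : measurableTypeR R -> \bar R) :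
  0 <= s <= 1 -> measurable_fun setT f -> (forall x, 0 <= f x)%E ->
  (\int[uniform_prob (@ltr01 R)]_x f (circle_rot s x) =
   \int[uniform_prob (@ltr01 R)]_x f x)%E.
Proof.
move=> /andP[s0 s1] mf f0.
have mfr : measurable_fun setT (f \o circle_rot s).
  exact: (measurableT_comp mf (measurable_circle_rot s)).
have f0r x : (0 <= (f \o circle_rot s) x)%E by exact: f0.
rewrite !integral_uniform//; congr (_ * _)%E.
rewrite (@ge0_integral_split _ (1 - s) _ (f \o circle_rot s))//; [|lra..].
rewrite (@ge0_integral_split _ s _ f)//.
rewrite addeC; congr (_ + _)%E.
- rewrite -[RHS](@ge0_integral_shift (s - 1))//.
  have <- : `[1 - s, 1[%classic = [set x : R | `[0, s[%classic (x + (s - 1))].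
    by apply/seteqP; split => x /=; rewrite !in_itv/=; lra.
  apply: eq_integral => x; rewrite inE /= in_itv /= /circle_rot => ?.
  by rewrite ifF ?addrA//; apply/negbTE; rewrite -leNgt; lra.
- rewrite -[RHS](@ge0_integral_shift s)//.
  have <- : `[0, 1 - s[%classic = [set x : R | `[s, 1[%classic (x + s)].
    by apply/seteqP; split => x /=; rewrite !in_itv/=; lra.
  apply: eq_integral => x; rewrite inE /= in_itv /= /circle_rot => ?.
  by rewrite ifT//; lra.
Qed.

Lemma cis_circle_rot (s x : R) :
  cis (2 * pi * circle_rot s x) = cis (2 * pi * s) * cis (2 * pi * x).
Proof.
rewrite -cisD /circle_rot; case: ifP => _; first by congr cis; ring.
rewrite [X in cis X](_ : _ = (2 * pi * s + 2 * pi * x) - pi *+ 2); last by ring.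
by rewrite !cisE -(cosD2pi (_ - _)) -(sinD2pi (_ - _)) subrK.
Qed.

Lemma cis_angle (x : R) : exists2 s : R, 0 <= s <= 1 & cis x = cis (2 * pi * s).
Proof.
have pi2 : 0 < 2 * pi :> R by rewrite mulr_gt0// pi_gt0.
exists (x / (2 * pi) - (Num.floor (x / (2 * pi)))%:~R).
  have := floor_itv (x / (2 * pi)).
  by rewrite intrD => /andP[? ?]; lra.
rewrite mulrBr mulrCA divff ?gt_eqF// mulr1.
set k := Num.floor _.
have cisZ (m : nat) : cis (2 * pi * m%:R : R) = 1.
  rewrite mulr_natr -cisMn [X in cis X](_ : _ = 0 + pi *+ 2); last by rewrite add0r mulr_natl.
  by rewrite cisE cosD2pi sinD2pi cos0 sin0 expr1n.
case: k => m; first by rewrite cisD -{1}[cis x]mulr1; congr (_ * _);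
  apply: (mulIf (oner_neq0 _)); rewrite mul1r -(cisZ m) -cisD addNr cis0.
by rewrite NegzE mulrNz mulrN opprK cisD cisZ mulr1.
Qed.

End rotation_of_the_circle.

Section coordinatewise_maps.
Context {d : measure_display} {T : measurableType d} {R : realType}.

Definition map_tuple_at n (phi : nat -> T -> T) (th : n.-tuple T) : n.-tuple T :=
  [tuple phi i (tnth th i) | i < n].

Lemma measurable_map_tuple_at n (phi : nat -> T -> T) :
  (forall i, measurable_fun setT (phi i)) ->
  measurable_fun setT (@map_tuple_at n phi).
Proof.
move=> mphi; apply/measurable_fun_tnthP => i.
rewrite [X in measurable_fun _ X](_ : _ = phi i \o (fun th => tnth th i)).
  by apply: measurableT_comp => //; exact: measurable_tnth.
by apply/funext => th /=; rewrite tnth_mktuple.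
Qed.

(** A power of a probability measure inherits the invariances of its factors,
    by Tonelli's theorem applied to one coordinate at a time. *)
Lemma ge0_integral_map_tuple_at (P : probability T R) n (phi : nat -> T -> T) :
  (forall i, measurable_fun setT (phi i)) ->
  (forall i (f : T -> \bar R), measurable_fun setT f -> (forall x, 0 <= f x)%E ->
    (\int[P]_x f (phi i x) = \int[P]_x f x)%E) ->
  forall F : n.-tuple T -> \bar R, measurable_fun setT F ->
  (forall th, 0 <= F th)%E ->
  (\int[tuple_prob P n]_th F (map_tuple_at phi th) = \int[tuple_prob P n]_th F th)%E.
Proof.
elim: n phi => [|n ih] phi mphi iphi F mF F0.
  by apply: eq_integral => th _; congr F; apply/eq_from_tnth => -[].
have mFm := measurableT_comp mF (@measurable_map_tuple_at n.+1 phi mphi).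
rewrite /= !ge0_integral_distribution//=.
have mFp : measurable_fun setT (F \o @pair_tuple _ T n).
  exact: (measurableT_comp mF (@measurable_pair_tuple _ _ n)).
have mFmp : measurable_fun setT (F \o @map_tuple_at n.+1 phi \o @pair_tuple _ T n).
  exact: (measurableT_comp mFm (@measurable_pair_tuple _ _ n)).
rewrite (fubini_tonelli1 _ mFmp (fun=> F0 _)).
rewrite (fubini_tonelli1 _ mFp (fun=> F0 _)).
rewrite /fubini_F /=.
under eq_integral => x _.
  rewrite [X in (\int[_]_y X y)%E](_ : _ = fun y => (F \o @pair_tuple _ T n)
    (phi 0%N x, map_tuple_at (fun i => phi i.+1) y)); last first.
    apply/funext => y /=; congr F; apply/eq_from_tnth => i.
    rewrite tnth_mktuple; case: (unliftP ord0 i) => [j|] ->.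
      by rewrite !tnthS tnth_mktuple lift0.
    by rewrite !tnth0.
  rewrite (ih _ _ _ (fun y => (F \o @pair_tuple _ T n) (phi 0%N x, y)))//; first over.
  + by move=> i; exact: iphi.
  + exact: (measurableT_comp mFp (measurable_pair1 _)).
  + by move=> th; exact: F0.
have := @measurable_fun_fubini_tonelli_F _ _ _ _ R (tuple_prob P n) _ mFp.
move=> /(_ (fun x => F0 _)) mG.
apply: (iphi 0%N (fun x =>
  \int[tuple_prob P n]_y (F \o @pair_tuple _ T n) (x, y))%E) => // x.
by apply: integral_ge0 => y _; exact: F0.
Qed.

End coordinatewise_maps.

(** * The H^p norm *)

Section Lnorm_properties.
Context {d : measure_display} {T : measurableType d} {R : realType}.
Variables (mu : {measure set T -> \bar R}) (p : R).
Hypothesis p1 : 1 <= p.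
Implicit Types f g : T -> R.

Let p0 : 0 < p. Proof. exact: lt_le_trans ltr01 p1. Qed.

Lemma Lnorm_powE (f : T -> \bar R) :
  ('N[mu]_p%:E[f] = (\int[mu]_x `|f x| `^ p) `^ p^-1)%E.
Proof. by rewrite unlock. Qed.

Lemma measurable_abse_poweR f : measurable_fun setT f ->
  measurable_fun setT (fun x => (`|(f x)%:E| `^ p)%E).
Proof.
move=> mf; apply: (measurableT_comp (measurable_poweR p)).
by apply: measurableT_comp => //; exact/measurable_EFinP.
Qed.

Lemma le_Lnorm f g : measurable_fun setT f -> measurable_fun setT g ->
  (forall x, `|f x| <= `|g x|) ->
  ('N[mu]_p%:E[EFin \o f] <= 'N[mu]_p%:E[EFin \o g])%E.
Proof.
move=> mf mg fg; rewrite !Lnorm_powE.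
apply: gt0_ler_poweR; first by rewrite invr_ge0 ltW.
- by rewrite in_itv /= leey andbT integral_ge0// => x _; exact: poweR_ge0.
- by rewrite in_itv /= leey andbT integral_ge0// => x _; exact: poweR_ge0.
apply: ge0_le_integral => //.
- by move=> x _; exact: poweR_ge0.
- exact: measurable_abse_poweR.
- exact: measurable_abse_poweR.
move=> x _; rewrite /= lee_fin; apply: ge0_ler_powR => //; rewrite ?ltW// nnegrE.
Qed.

Lemma LnormZl (k : R) f : measurable_fun setT f ->
  ('N[mu]_p%:E[EFin \o (fun x => k * f x)%R] = `|k|%R%:E * 'N[mu]_p%:E[EFin \o f])%E.
Proof.
move=> mf; rewrite !Lnorm_powE.
under eq_integral => x _ do rewrite /= normrM powRM// EFinM.
have ? : (0 <= \int[mu]_x (`|f x| `^ p)%:E)%E.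
  by apply: integral_ge0 => x _; rewrite lee_fin powR_ge0.
rewrite ge0_integralZl ?lee_fin ?powR_ge0//.
- by rewrite poweRM ?lee_fin ?powR_ge0// -poweR_EFin -poweRrM divff ?gt_eqF// poweRe1.
- exact: measurable_abse_poweR.
Qed.

End Lnorm_properties.

Section measurable_complex.
Context {d : measure_display} {T : measurableType d} {R : realType}.
Implicit Types f g : T -> R[i].

Definition measurable_cfun f :=
  measurable_fun setT (fun x => complex.Re (f x)) /\
  measurable_fun setT (fun x => complex.Im (f x)).

Lemma measurable_cfun_cst z : measurable_cfun (fun=> z).
Proof. by split; exact: measurable_cst. Qed.

Lemma measurable_cfunD f g : measurable_cfun f -> measurable_cfun g ->
  measurable_cfun (fun x => f x + g x).
Proof.
move=> [rf jf] [rg jg]; split.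
  by under eq_fun do rewrite cReD; exact: measurable_funD.
by under eq_fun do rewrite cImD; exact: measurable_funD.
Qed.

Lemma measurable_cfunM f g : measurable_cfun f -> measurable_cfun g ->
  measurable_cfun (fun x => f x * g x).
Proof.
move=> [rf jf] [rg jg]; split.
  under eq_fun do rewrite cReM.
  by apply: measurable_funB; exact: measurable_funM.
under eq_fun do rewrite cImM.
by apply: measurable_funD; exact: measurable_funM.
Qed.

Lemma measurable_cfun_sum (I : Type) (s : seq I) (F : I -> T -> R[i]) :
  (forall i, measurable_cfun (F i)) ->
  measurable_cfun (fun x => \sum_(i <- s) F i x).
Proof.
move=> mF; elim: s => [|i s ih].
  by under eq_fun do rewrite big_nil; exact: measurable_cfun_cst.
by under eq_fun do rewrite big_cons; exact: measurable_cfunD.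
Qed.

Lemma measurable_cfun_prod (I : Type) (s : seq I) (F : I -> T -> R[i]) :
  (forall i, measurable_cfun (F i)) ->
  measurable_cfun (fun x => \prod_(i <- s) F i x).
Proof.
move=> mF; elim: s => [|i s ih].
  by under eq_fun do rewrite big_nil; exact: measurable_cfun_cst.
by under eq_fun do rewrite big_cons; exact: measurable_cfunM.
Qed.

Lemma measurable_cfunX f n : measurable_cfun f ->
  measurable_cfun (fun x => f x ^+ n).
Proof.
move=> mf; elim: n => [|n ih].
  by under eq_fun do rewrite expr0; exact: measurable_cfun_cst.
by under eq_fun do rewrite exprS; exact: measurable_cfunM.
Qed.

Lemma measurable_cfun_cis (h : T -> R) : measurable_fun setT h ->
  measurable_cfun (fun x => cis (h x)).
Proof.
move=> mh; split.
  under eq_fun do rewrite cisE /=.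
  apply: measurableT_comp => //; apply: continuous_measurable_fun.
  exact: continuous_cos.
under eq_fun do rewrite cisE /=.
apply: measurableT_comp => //; apply: continuous_measurable_fun.
exact: continuous_sin.
Qed.

Lemma measurable_normc f : measurable_cfun f ->
  measurable_fun setT (fun x => normc (f x)).
Proof.
move=> [rf jf]; under eq_fun do rewrite normc_sqrtE.
apply: (@measurableT_comp _ _ _ _ _ _ (@Num.sqrt R)).
  by apply: continuous_measurable_fun; exact: sqrt_continuous.
by apply: measurable_funD; exact: measurable_funX.
Qed.

End measurable_complex.

Section hardy_seminorm.
Context {R : realType}.
Implicit Types (P : @dirichlet_poly R) (a b : nat -> R[i]).

(** The norm reads the dimension of the torus off the support. Keeping the
    support while the coefficients vary keeps all norms on the same torus. *)
Definition with_coef P a := DirichletPoly a (dsupp_pos P).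

Lemma with_coefE P : with_coef P (dcoef P) = P.
Proof. by case: P. Qed.

Lemma dsupp_gt0 P n : n \in dsupp P -> (0 < n)%N.
Proof. by case: n => //; rewrite (negbTE (dsupp_pos P)). Qed.

Lemma le_max_dsupp P n : n \in dsupp P -> (n <= \max_(m <- dsupp P) m)%N.
Proof. by move=> nP; rewrite (big_rem n)//= leq_maxl. Qed.

Lemma torus_pointE y (th : (size (primes_upto y)).-tuple R) r :
  torus_point th r = cis (2 * pi * nth 0 th (index r (primes_upto y))).
Proof. by []. Qed.

Lemma normc_torus_point y (th : (size (primes_upto y)).-tuple R) r :
  normc (torus_point th r) = 1.
Proof. by rewrite torus_pointE normc_cis. Qed.

Lemma normcX (z : R[i]) n : normc (z ^+ n) = normc z ^+ n.
Proof.
elim: n => [|n ih]; last by rewrite !exprS normcM ih.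
by rewrite !expr0 complex.ComplexField.Normc.normc1.
Qed.

Lemma normc_bohr_lift P y (th : (size (primes_upto y)).-tuple R) :
  normc (bohr_lift P (torus_point th)) <= \sum_(n <- dsupp P) normc (dcoef P n).
Proof.
rewrite (le_trans (normc_sum _ _))//; apply: ler_sum => n _.
rewrite normcM ler_piMr ?normc_ge0//.
rewrite [leLHS](_ : _ = 1)//.
elim/big_rec: _ => [|r z _ zE]; first exact: complex.ComplexField.Normc.normc1.
by rewrite normcM zE normcX normc_torus_point expr1n mulr1.
Qed.

Lemma measurable_bohr_lift P y :
  measurable_fun setT (fun th : (size (primes_upto y)).-tuple (measurableTypeR R)
    => normc (bohr_lift P (torus_point th))).
Proof.
apply: measurable_normc; apply: measurable_cfun_sum => n.
apply: measurable_cfunM; first exact: measurable_cfun_cst.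
apply: measurable_cfun_prod => r; apply: measurable_cfunX.
apply: measurable_cfun_cis; apply: measurable_funM; first exact: measurable_cst.
set i := index _ _; have [ilt|ige] := ltnP i (size (primes_upto y)).
  rewrite [X in measurable_fun _ X](_ : _ = fun th => tnth th (Ordinal ilt)).
    exact: measurable_tnth.
  by apply/funext => th; rewrite (tnth_nth 0).
under eq_fun => th do rewrite nth_default ?size_tuple//.
exact: measurable_cst.
Qed.

Variables (p : R) (p1 : 1 <= p).

Lemma hardy_norm_ge0 P : (0 <= hardy_norm p P)%E.
Proof. exact: Lnorm_ge0. Qed.

Lemma hardy_norm_le_sum P :
  (hardy_norm p P <= (\sum_(n <- dsupp P) normc (dcoef P n))%:E)%E.
Proof.
rewrite /hardy_norm /hardy_norm_at; set y := \max_(_ <- _) _.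
set S := \sum_(_ <- _) _.
have S0 : 0 <= S by rewrite sumr_ge0// => n _; rewrite normc_ge0.
have -> : S%:E = ('N[@haar_angles R y]_p%:E[EFin \o (fun x => S * cst 1 x)%R])%E.
  rewrite LnormZl//.
  have := @Lnorm_cst1 _ _ _ (@haar_angles R y) p.
  rewrite [X in (X `^ _)%E](@probability_setT _ _ _ (@haar_angles R y)) poweR_EFin powR1.
  by rewrite ger0_norm// => ->; rewrite mule1.
apply: le_Lnorm => //; first exact: measurable_bohr_lift.
  exact: (@measurable_cst _ _ _ _ _ (S * 1)).
move=> th; rewrite mulr1 !ger0_norm ?normc_ge0//; exact: normc_bohr_lift.
Qed.

Lemma hardy_norm_fin P : hardy_norm p P \is a fin_num.
Proof.
rewrite ge0_fin_numE ?hardy_norm_ge0//.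
by rewrite (le_lt_trans (hardy_norm_le_sum P)) ?ltry.
Qed.

Definition hpnorm P : R := fine (hardy_norm p P).

Lemma hpnormE P : hardy_norm p P = (hpnorm P)%:E.
Proof. by rewrite /hpnorm fineK// hardy_norm_fin. Qed.

Lemma hpnorm_ge0 P : 0 <= hpnorm P.
Proof. by rewrite fine_ge0// hardy_norm_ge0. Qed.

(** The Bohr lift is bounded on the torus by the sum of the moduli of its
    coefficients. This crude bound serves for finiteness and to discard the
    truncation errors of the arcsine series. *)
Lemma hpnorm_le_sum P : hpnorm P <= \sum_(n <- dsupp P) normc (dcoef P n).
Proof. by rewrite -lee_fin -hpnormE hardy_norm_le_sum. Qed.

Lemma eq_hpnorm P a b : {in dsupp P, a =1 b} ->
  hpnorm (with_coef P a) = hpnorm (with_coef P b).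
Proof.
move=> ab; congr fine; rewrite /hardy_norm /hardy_norm_at /=.
apply: eq_Lnorm => th; congr (normc _)%:E; rewrite /bohr_lift /=.
by rewrite big_seq [RHS]big_seq; apply: eq_bigr => n nP; rewrite ab.
Qed.

Lemma hpnormD P a b : hpnorm (with_coef P (fun n => a n + b n)) <=
  hpnorm (with_coef P a) + hpnorm (with_coef P b).
Proof.
rewrite -lee_fin EFinD -!hpnormE /hardy_norm /hardy_norm_at /=.
set y := \max_(_ <- _) _.
apply: le_trans; last first.
  by apply: minkowski_EFin => //; exact: measurable_bohr_lift.
apply: le_Lnorm => //; first exact: measurable_bohr_lift.
  by apply: measurable_funD; exact: measurable_bohr_lift.
move=> th /=; rewrite !ger0_norm ?addr_ge0 ?normc_ge0//.
rewrite -(_ : bohr_lift (with_coef P a) (torus_point th) +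
  bohr_lift (with_coef P b) (torus_point th) = bohr_lift _ _) ?le_normcD//.
by rewrite /bohr_lift -big_split; apply: eq_bigr => n _; rewrite mulrDl.
Qed.

Lemma hpnormZ P (k : R[i]) a : hpnorm (with_coef P (fun n => k * a n)) =
  normc k * hpnorm (with_coef P a).
Proof.
apply: EFin_inj; rewrite EFinM -!hpnormE /hardy_norm /hardy_norm_at /=.
set y := \max_(_ <- _) _.
rewrite -[in RHS](ger0_norm (normc_ge0 k)) -LnormZl//; last first.
  exact: measurable_bohr_lift.
apply: eq_Lnorm => th /=; congr EFin; rewrite -normcM; congr normc.
by rewrite /bohr_lift mulr_sumr; apply: eq_bigr => n _; rewrite mulrA.
Qed.

(** The logarithm is completely additive: the twist by [n ^ (i alpha)] is a
    character, fixed by its values at the primes. *)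
Lemma prod_cis_logn (alpha : R) n : (0 < n)%N ->
  \prod_(r <- primes n) cis (alpha * ln r%:R) ^+ logn r n = cis (alpha * ln n%:R).
Proof.
move=> n0; rewrite [in RHS](prod_prime_decomp n0) prime_decompE big_map /=.
have : all (fun r => 0 < r)%N (primes n).
  by apply/allP => r; rewrite mem_primes => /andP[/prime_gt0].
elim: (primes n) => [|r s ih] /=; first by rewrite !big_nil ln1 mulr0 cis0.
move=> /andP[r0 s0]; rewrite !big_cons ih// cisMn -cisD; congr cis.
rewrite natrM lnM ?posrE ?ltr0n ?expn_gt0 ?r0//.
  by rewrite natrX lnXn ?ltr0n// mulrDr mulrnAr.
by elim: s s0 {ih} => [|q s ih] /=; rewrite ?big_nil// big_cons muln_gt0
  expn_gt0 => /andP[-> /ih].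
Qed.

(** Multiplying [a n] by [n ^ (i alpha)] amounts to rotating the variable [z_r]
    by the angle [alpha ln r], and Haar measure does not see rotations. *)
Lemma hpnorm_rot P (alpha : R) a :
  hpnorm (with_coef P (fun n => a n * cis (alpha * ln n%:R))) =
  hpnorm (with_coef P a).
Proof.
congr fine; rewrite /hardy_norm /hardy_norm_at /=; set y := \max_(_ <- _) _.
(* the angle of the rotation of the variable z_r, in turns *)
pose s r := sval (cid2 (cis_angle (alpha * ln r%:R))).
have s01 r : 0 <= s r <= 1 by rewrite /s; case: cid2.
have sE r : cis (alpha * ln r%:R) = cis (2 * pi * s r).
  by rewrite /s; case: cid2.
pose phi i : measurableTypeR R -> measurableTypeR R :=
  circle_rot (s (nth 0%N (primes_upto y) i)).
have mphi i : measurable_fun setT (phi i) by exact: measurable_circle_rot.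
have mF : measurable_fun setT
    (fun th : (size (primes_upto y)).-tuple (measurableTypeR R) =>
     `|(normc (bohr_lift (with_coef P a) (torus_point th)))%:E| `^ p)%E.
  by apply: measurable_abse_poweR; exact: measurable_bohr_lift.
have iphi i (f : measurableTypeR R -> \bar R) : measurable_fun setT f ->
    (forall x, 0 <= f x)%E ->
    (\int[uniform_prob (@ltr01 R)]_x f (phi i x) =
     \int[uniform_prob (@ltr01 R)]_x f x)%E.
  by move=> mf f0; exact: ge0_integral_circle_rot.
have := @ge0_integral_map_tuple_at _ _ _ _ _ _ mphi iphi _ mF
  (fun=> poweR_ge0 _ _).
rewrite -/(haar_angles y) => E.
rewrite !Lnorm_powE; apply: (congr1 (fun x => x `^ p^-1)%E).
rewrite -[RHS]E.
apply: eq_integral => th _; congr (`|(normc _)%:E| `^ _)%E.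
rewrite /bohr_lift /= big_seq [RHS]big_seq; apply: eq_bigr => n nP.
rewrite -mulrA; congr (_ * _).
rewrite -(prod_cis_logn _ (dsupp_gt0 nP)) -big_split/=.
rewrite big_seq [RHS]big_seq; apply: eq_bigr => r; rewrite mem_primes => /and3P[pr n0 rn].
rewrite -exprMn; congr (_ ^+ _).
have ry : r \in primes_upto y.
  rewrite mem_filter pr mem_iota add0n ltnS /=.
  exact: leq_trans (dvdn_leq n0 rn) (le_max_dsupp nP).
rewrite !torus_pointE sE.
have ri : (index r (primes_upto y) < size (primes_upto y))%N by rewrite index_mem.
have -> : nth 0 (map_tuple_at phi th) (index r (primes_upto y)) =
    circle_rot (s r) (nth 0 th (index r (primes_upto y))).
  rewrite -[index _ _]/(val (Ordinal ri)) -!tnth_nth tnth_mktuple /phi.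
  by rewrite nth_index.
by rewrite cis_circle_rot.
Qed.

End hardy_seminorm.

(** * The arcsine series and the inverse sinc *)

Section arcsine_series.
Context {R : realType}.
Implicit Types (x : R) (N j : nat).

(** [central_ratio j] is [binomial (2 j) j / 4 ^ j]; these are the Taylor
    coefficients of [1 / sqrt (1 - y)]. *)
Fixpoint central_ratio j : R :=
  if j is k.+1 then central_ratio k * (k.*2.+1%:R / k.*2.+2%:R) else 1.

Definition asin_coef j : R := central_ratio j / j.*2.+1%:R.

Lemma central_ratio_ge0 j : 0 <= central_ratio j.
Proof. by elim: j => //= j ih; rewrite mulr_ge0// divr_ge0. Qed.

Lemma central_ratio_le1 j : central_ratio j <= 1.
Proof.
elim: j => //= j ih; rewrite mulr_ile1 ?central_ratio_ge0 ?divr_ge0//.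
by rewrite ler_pdivrMr ?mul1r ?ltr0n// ler_nat.
Qed.

Lemma asin_coef_ge0 j : 0 <= asin_coef j.
Proof. by rewrite divr_ge0// central_ratio_ge0. Qed.

(** Telescoping: [central_ratio j - central_ratio j.+1] equals
    [central_ratio j / (2 j + 2)], at least half of [asin_coef j]. *)
Lemma sum_asin_coef N : \sum_(j < N) asin_coef j <= 2.
Proof.
have : \sum_(j < N) asin_coef j <= 2 * (1 - central_ratio N).
  elim: N => [|N ih]; first by rewrite big_ord0 subrr mulr0.
  rewrite big_ord_recr /= (le_trans (lerD ih (lexx _)))//.
  have b0 := central_ratio_ge0 N.
  rewrite /asin_coef -subr_ge0.
  rewrite [leRHS](_ : _ = central_ratio N * (2 / N.*2.+2%:R - 1 / N.*2.+1%:R)); last first.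
    by rewrite -addn2 natrD -addn1 natrD; field; apply/andP; split; rewrite -?natrD ?pnatr_eq0 ?addn1 ?addn2.
  rewrite mulr_ge0// subr_ge0 ler_pdivrMr ?ltr0n// mulrAC ler_pdivlMr ?ltr0n//.
  by rewrite mul1r -natrM ler_nat; lia.
by move/le_trans; apply; have := central_ratio_ge0 N; lra.
Qed.

Definition asin_sin N x : R := \sum_(j < N) asin_coef j * sin x ^+ j.*2.+1.

Definition asin_sin' N x : R := cos x * \sum_(j < N) central_ratio j * sin x ^+ j.*2.

Lemma is_derive_scaled_power (f : R -> R) (df a x : R) n :
  is_derive x 1 f df ->
  is_derive x 1 (fun y => a * f y ^+ n) (a * (n%:R * f x ^+ n.-1 * df)).
Proof.
move=> fdf; have -> : (fun y => a * f y ^+ n) = a *: (f ^+ n).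
  by apply/funext => y; rewrite /GRing.scale/= exprfctE.
exact: is_deriveZ.
Qed.

Lemma is_derive_asin_sin N x : is_derive x 1 (asin_sin N) (asin_sin' N x).
Proof.
rewrite /asin_sin'; elim: N => [|N ih].
  rewrite big_ord0 mulr0 (_ : asin_sin 0 = cst 0); first exact: is_derive_cst.
  by apply/funext => y; rewrite /asin_sin big_ord0.
rewrite (_ : asin_sin N.+1 =
  asin_sin N \+ (fun y => asin_coef N * sin y ^+ N.*2.+1)); last first.
  by apply/funext => y; rewrite /asin_sin big_ord_recr.
rewrite big_ord_recr mulrDr; apply: is_deriveD.
apply: (is_derive_eq (is_derive_scaled_power _ _ (is_derive_sin x))).
have : N.*2.+1%:R != 0 :> R by rewrite pnatr_eq0.
by rewrite /asin_coef /=; set k := N.*2.+1%:R => k0; field.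
Qed.

(** The recurrence [(2 j + 2) central_ratio j.+1 = (2 j + 1) central_ratio j]
    makes the derivative telescope: only the boundary term survives. In the
    limit, [cos] times the series is constant. *)
Lemma is_derive_asin_sin' N x : is_derive x 1 (asin_sin' N)
  (- (N.*2%:R * central_ratio N * sin x ^+ N.*2.-1)).
Proof.
elim: N => [|N ih].
  rewrite double0 !mul0r oppr0 (_ : asin_sin' 0 = cst 0).
    exact: is_derive_cst.
  by apply/funext => y; rewrite /asin_sin' big_ord0 mulr0.
rewrite (_ : asin_sin' N.+1 =
  asin_sin' N \+ (fun y => central_ratio N * sin y ^+ N.*2) * cos); last first.
  by apply/funext => y; rewrite /asin_sin' big_ord_recr /= mulrDr;
    congr (_ + _); rewrite [LHS]mulrC.
apply: is_derive_eq.
  apply: is_deriveD; apply: is_deriveM.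
  exact: (is_derive_scaled_power _ _ (is_derive_sin x)).
have cs := cos2Dsin2 x.
rewrite /= /GRing.scale /= doubleS /=.
have -> : N.*2.+2%:R * (central_ratio N * (N.*2.+1%:R / N.*2.+2%:R)) = N.*2.+1%:R * central_ratio N.
  by have : N.*2.+2%:R != 0 :> R; [rewrite pnatr_eq0 | set k := N.*2.+2%:R => k0; field].
case: N.*2 => [|n] /=; first by rewrite expr0 expr1; ring.
have -> : cos x * (central_ratio N * (n.+1%:R * sin x ^+ n * cos x)) =
  n.+1%:R * central_ratio N * sin x ^+ n * (1 - sin x ^+ 2).
  by rewrite -cs addrK expr2; ring.
by rewrite !exprS -[n.+2]addn1 natrD; ring.
Qed.

Lemma le_mean_value (f df : R -> R) (b K : R) : 0 <= b ->
  (forall x, is_derive x 1 f (df x)) -> (forall x, 0 <= x <= b -> `|df x| <= K) ->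
  `|f b - f 0| <= K * b.
Proof.
move=> b0 fdf dfK.
have cf : {within `[0, b], continuous f}.
  by apply: derivable_within_continuous => x _; exact: ex_derive.
have [c cb ->] := MVT_segment b0 (fun x _ => fdf x) cf.
rewrite subr0 normrM (ger0_norm b0) ler_wpM2r// dfK//.
Qed.

Lemma abs_sin_le (x : R) : 0 <= x -> `|sin x| <= x.
Proof.
move=> x0; rewrite -[sin x]subr0 -(@sin0 R) -[leRHS]mul1r.
apply: (le_mean_value (df := cos)) => // y _.
by rewrite ler_norml cos_geN1 cos_le1.
Qed.

Lemma asin_sin'_near1 N (x : R) : 0 <= x <= 2^-1 ->
  `|asin_sin' N.+1 x - 1| <= 2 * (2^-1) ^+ N.
Proof.
move=> /andP[x0 x1].
have T0 : asin_sin' N.+1 0 = 1.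
  rewrite /asin_sin' cos0 mul1r sin0 big_ord_recl /= expr0 mulr1 big1 ?addr0// => j _.
  by rewrite doubleS expr0n mulr0.
rewrite -[X in _ - X]T0; set K := leRHS; have K0 : 0 <= K by rewrite mulr_ge0// exprn_ge0.
apply: (@le_trans _ _ (K * x)); last by rewrite ler_piMr//; lra.
apply: (le_mean_value (df := fun y => - (N.+1.*2%:R * central_ratio N.+1 * sin y ^+ N.+1.*2.-1))) => //.
  by move=> y; exact: is_derive_asin_sin'.
move=> y /andP[y0 yx].
move: (central_ratio N.+1) (central_ratio_ge0 N.+1) (central_ratio_le1 N.+1) => b b0 b1.
rewrite normrN !normrM normrX (ger0_norm b0) (ger0_norm (ler0n _ _)).
apply: (@le_trans _ _ (N.+1.*2%:R * 1 * (2^-1) ^+ N.+1.*2.-1)).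
  rewrite ler_pM ?mulr_ge0 ?exprn_ge0//.
    by rewrite ler_pM2l ?ltr0n.
  rewrite lerXn2r ?nnegrE// ?invr_ge0//.
  by rewrite (le_trans (abs_sin_le y0))//; lra.
have NN : N.+1%:R * (2^-1) ^+ N <= 1 :> R.
  by rewrite exprVn ler_pdivrMr ?exprn_gt0// mul1r -natrX ler_nat ltn_expl.
rewrite doubleS /= mulr1 exprS -addnn exprD.
rewrite [leLHS](_ : _ = N.+1%:R * (2^-1) ^+ N * (2^-1) ^+ N); last first.
  rewrite addnn -doubleS -mul2n natrM; by move: (2^-1 ^+ N) => u; field.
rewrite (le_trans (y := 1 * (2^-1) ^+ N)) ?ler_wpM2r ?exprn_ge0//.
by rewrite ler1n.
Qed.

(** At [0] the value is the limit, so that the term [n = 1], of frequency zero,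
    is left unchanged. *)
Definition inv_sinc x : R := if x == 0 then 1 else x / sin x.

Lemma sin_pos x : 0 < x <= 2^-1 -> 0 < sin x.
Proof.
move=> /andP[x0 x1]; apply: sin_gt0_pi; rewrite x0 /=.
by have := @pi_ge2 R; lra.
Qed.

Lemma inv_sincK x : 0 <= x <= 2^-1 -> inv_sinc x * sin x = x.
Proof.
rewrite /inv_sinc; case: eqVneq => [->|x0 /andP[x1 x2]]; first by rewrite sin0 mulr0.
by rewrite divfK// gt_eqF// sin_pos// x2 andbT lt_neqAle eq_sym x0.
Qed.

(** The arcsine series [arcsin y = \sum_j asin_coef j * y ^ (2 j + 1)] at
    [y = sin x], divided by [y]. *)
Lemma cvg_inv_sinc x : 0 <= x <= 2^-1 ->
  (fun N => \sum_(j < N) asin_coef j * sin x ^+ j.*2) @ \oo --> inv_sinc x.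
Proof.
move=> /andP[x0 x1]; rewrite -cvg_shiftS /=.
have [->|xn0] := eqVneq x 0.
  rewrite [X in X @ _ --> _](_ : _ = cst (inv_sinc 0)); first exact: cvg_cst.
  apply/funext => N; rewrite /inv_sinc eqxx sin0 big_ord_recl /= big1 ?addr0.
    by rewrite expr0 mulr1 /asin_coef /= divr1.
  by move=> j _; rewrite doubleS expr0n mulr0.
have xgt0 : 0 < x by rewrite lt_neqAle eq_sym xn0.
have s0 : 0 < sin x by rewrite sin_pos// xgt0.
have E N : inv_sinc x - \sum_(j < N) asin_coef j * sin x ^+ j.*2 =
    (x - asin_sin N x) / sin x.
  rewrite mulrBl /inv_sinc (negbTE xn0); congr (_ - _).
  rewrite /asin_sin mulr_suml; apply: eq_bigr => j _.
  by rewrite exprSr mulrA mulfK ?gt_eqF.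
have B N : `|x - asin_sin N.+1 x| <= 2 * (2^-1) ^+ N * x.
  have -> : x - asin_sin N.+1 x = (x - asin_sin N.+1 x) - (0 - asin_sin N.+1 0).
    rewrite /asin_sin [X in _ - (0 - X)]big1 ?subrr ?subr0// => j _.
    by rewrite sin0 expr0n mulr0.
  apply: (le_mean_value (f := fun y => y - asin_sin N.+1 y)
    (df := fun y => 1 - asin_sin' N.+1 y)) => //.
    by move=> y; apply: is_deriveB; exact: is_derive_asin_sin.
  by move=> y /andP[y0 yx]; rewrite distrC asin_sin'_near1// y0/=; lra.
apply/cvgrPdist_le => e e0.
have : (fun N => 2 * x / sin x * (2^-1) ^+ N) @ \oo --> 2 * x / sin x * 0.
  apply: cvgMr; apply: cvg_expr; rewrite ger0_norm//; lra.
rewrite mulr0 => /cvgrPdist_le/(_ e e0); apply: filterS => N.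
rewrite sub0r normrN => /(le_trans (ler_norm _)); apply: le_trans.
rewrite E normrM normfV (gtr0_norm s0).
rewrite ler_pdivrMr//.
rewrite [leRHS](_ : _ = 2 * (2^-1) ^+ N * x)//.
by rewrite mulrAC mulfVK ?gt_eqF//; ring.
Qed.

End arcsine_series.

(** * Division by sinc is bounded on H^p *)

Section sinc_multiplier.
Context {R : realType}.
Variables (p : R) (p1 : 1 <= p).
Implicit Types (P : @dirichlet_poly R) (a : nat -> R[i]).

(** The multiplier is half a difference of two norm-preserving twists. *)
Lemma hpnorm_sin P (delta : R) a :
  hpnorm p (with_coef P (fun n => a n * Complex (sin (delta * ln n%:R)) 0)) <=
  hpnorm p (with_coef P a).
Proof.
rewrite (@eq_hpnorm _ p P _ (fun n => Complex 0 (- 2^-1) * (a n * cis (delta * ln n%:R)) +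
    Complex 0 2^-1 * (a n * cis (- delta * ln n%:R)))); last first.
  by move=> n _; rewrite sin_cis mulNr mulrDr; congr (_ + _); exact: mulrCA.
rewrite (le_trans (hpnormD p1 _ _ _))// !hpnormZ// !hpnorm_rot// -mulrDl.
rewrite !normc_sqrtE /= sqrrN expr0n add0r sqrtr_sqr ger0_norm//.
by rewrite (_ : 2^-1 + 2^-1 = 1 :> R) ?mul1r//; lra.
Qed.

Lemma hpnorm_sinX P (delta : R) k a :
  hpnorm p (with_coef P (fun n => a n * Complex (sin (delta * ln n%:R) ^+ k) 0)) <=
  hpnorm p (with_coef P a).
Proof.
elim: k => [|k ih].
  rewrite (@eq_hpnorm _ p P _ a)// => n _.
  by rewrite expr0 -[Complex 1 0]/(1 : R[i]) mulr1.
apply: le_trans ih; apply: le_trans (hpnorm_sin _ delta _).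
rewrite (@eq_hpnorm _ p P _ (fun n => a n * Complex (sin (delta * ln n%:R) ^+ k) 0 *
  Complex (sin (delta * ln n%:R)) 0))// => n _.
rewrite -mulrA; congr (_ * _); rewrite exprSr.
by apply/eqP; rewrite eq_complex /= !mulr0 !mul0r subr0 addr0 !eqxx.
Qed.

Lemma hpnorm_asin_partial_sum P (delta : R) N a :
  hpnorm p (with_coef P (fun n => a n *
    Complex (\sum_(j < N) asin_coef j * sin (delta * ln n%:R) ^+ j.*2) 0)) <=
  (\sum_(j < N) asin_coef j) * hpnorm p (with_coef P a).
Proof.
elim: N => [|N ih].
  rewrite big_ord0 mul0r (@eq_hpnorm _ p P _ (fun n => 0 * a n)) => [|n _].
    by rewrite hpnormZ// complex.ComplexField.Normc.normc0 mul0r.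
  by rewrite big_ord0 -[Complex 0 0]/(0 : R[i]) mulr0 mul0r.
rewrite (@eq_hpnorm _ p P _ (fun n => a n *
    Complex (\sum_(j < N) asin_coef j * sin (delta * ln n%:R) ^+ j.*2) 0 +
    Complex (asin_coef N) 0 * (a n * Complex (sin (delta * ln n%:R) ^+ N.*2) 0))).
  rewrite (le_trans (hpnormD p1 _ _ _))// big_ord_recr /= mulrDl lerD//.
  rewrite hpnormZ// normc_real ger0_norm ?asin_coef_ge0//.
  by rewrite ler_wpM2l ?asin_coef_ge0// hpnorm_sinX.
move=> n _; rewrite big_ord_recr /= mulrCA -mulrDr; congr (_ * _).
by apply/eqP; rewrite eq_complex /= !mulr0 !mul0r subr0 !addr0 !eqxx.
Qed.

(** Up to a truncation error, which vanishes in the limit because the support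
    is finite, dividing by the sinc of the frequency is a combination of powers
    of the multiplier [sin (delta ln n)]. These powers are contractions, and
    their coefficients sum to at most two. *)
Lemma hpnorm_inv_sinc P (delta : R) :
  (forall n, n \in dsupp P -> 0 <= delta * ln n%:R <= 2^-1) ->
  hpnorm p (with_coef P (fun n => dcoef P n *
    Complex (inv_sinc (delta * ln n%:R)) 0)) <= 2 * hpnorm p P.
Proof.
move=> hx; apply/ler_addgt0Pr => e e0.
pose q N n : R := \sum_(j < N) asin_coef j * sin (delta * ln n%:R) ^+ j.*2.
have : (fun N => \sum_(n <- dsupp P)
    normc (dcoef P n) * `|inv_sinc (delta * ln n%:R) - q N n|) @ \oo --> (0 : R).
  rewrite [X in _ --> X](_ : _ = \sum_(n <- dsupp P | n \in dsupp P)
      normc (dcoef P n) * 0); last by rewrite big1// => n _; rewrite mulr0.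
  under eq_fun do rewrite big_seq.
  apply: cvg_big => [|n nP]; first exact: add_continuous.
  apply: cvgMr; rewrite -[X in _ --> X](@normr0 _ R); apply: cvg_norm.
  rewrite -[X in _ --> X](subrr (inv_sinc (delta * ln n%:R))).
  by apply: cvgB; [exact: cvg_cst | exact: cvg_inv_sinc (hx _ nP)].
move/cvgrPdist_le => /(_ e e0) [N _ /(_ N (leqnn N))] /=.
rewrite sub0r normrN => /(le_trans (ler_norm _)) le_e.
rewrite (@eq_hpnorm _ p P _ (fun n => dcoef P n * Complex (q N n) 0 +
   dcoef P n * Complex (inv_sinc (delta * ln n%:R) - q N n) 0)); last first.
  move=> n _; rewrite -mulrDr; congr (_ * _).
  by apply/eqP; rewrite eq_complex /= addr0 addrC subrK !eqxx.
rewrite (le_trans (hpnormD p1 _ _ _))// lerD//.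
  rewrite (le_trans (hpnorm_asin_partial_sum _ _ _ _))// with_coefE.
  by rewrite ler_wpM2r ?hpnorm_ge0// sum_asin_coef.
rewrite (le_trans (hpnorm_le_sum p1 _))// (le_trans _ le_e)//.
by apply: ler_sum => n _; rewrite normcM normc_real.
Qed.

End sinc_multiplier.

(** * Point values as window averages *)

Section sampling.
Context {R : realType}.
Implicit Types (P : @dirichlet_poly R) (t tau delta : R).
Local Notation mu := (@lebesgue_measure R).

Lemma deval_critical P t : deval P (critical t) =
  \sum_(n <- dsupp P) dcoef P n * Complex (expR (- (2^-1 * ln n%:R))) 0 *
    cis (- (t * ln n%:R)).
Proof.
rewrite /deval; apply: eq_bigr => n _; rewrite -mulrA; congr (_ * _).
rewrite cisE /cexp /critical /= !mulr0 add0r subr0 !mulNr.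
by apply/eqP; rewrite eq_complex /= !mul0r subr0 addr0 !eqxx.
Qed.

Definition cval P t := normc (deval P (critical t)).

Lemma cval_ge0 P t : 0 <= cval P t.
Proof. exact: normc_ge0. Qed.

Lemma measurable_cval P : measurable_fun setT (cval P).
Proof.
apply: measurable_normc; under eq_fun do rewrite deval_critical.
apply: measurable_cfun_sum => n.
apply: measurable_cfunM; first exact: measurable_cfun_cst.
apply: measurable_cfun_cis; apply: measurableT_comp => //.
exact: measurable_funM.
Qed.

Lemma measurable_cval_powR P (p : R) :
  measurable_fun setT (fun t => (cval P t `^ p)%:E).
Proof.
apply/measurable_EFinP; apply: (measurableT_comp (measurable_powR p)).
exact: measurable_cval.
Qed.

(** A primitive of the wave [x cos (l t) + y sin (l t)]; frequency zero, that is
    [n = 1], is an exception to the formula. *)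
Definition window_primitive (l x y t : R) : R :=
  if l == 0 then x * t else (x * sin (l * t) - y * cos (l * t)) / l.

Lemma is_derive_window_primitive (l x y t : R) :
  is_derive t 1 (window_primitive l x y) (x * cos (l * t) + y * sin (l * t)).
Proof.
rewrite /window_primitive; have [->|l0] := eqVneq l 0.
  rewrite mul0r cos0 sin0 mulr0 addr0.
  by apply: is_derive_eq; rewrite /GRing.scale.
have hl : is_derive t 1 (fun u : R => l * u) l.
  by apply: is_derive_eq; rewrite /GRing.scale/= mulr1.
pose sl (u : R) := sin (l * u); pose cl (u : R) := cos (l * u).
have hs : is_derive t 1 sl (cos (l * t) * l) by exact: is_derive1_comp.
have hc : is_derive t 1 cl (- sin (l * t) * l) by exact: is_derive1_comp.
rewrite [X in is_derive _ _ X _](_ : _ = l^-1 *: (x *: sl - y *: cl)); last first.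
  by apply/funext => u; rewrite [LHS]mulrC.
apply: is_derive_eq.
rewrite /GRing.scale /=.
by field.
Qed.

(** Integrating a wave of frequency [l] over a window of half-width [delta]
    multiplies its central value by [2 delta] sinc (delta l); the factor in front
    undoes the sinc. *)
Lemma window_primitive_diff (l x y tau delta : R) : 0 < delta ->
  0 <= delta * l <= 2^-1 ->
  inv_sinc (delta * l) *
    (window_primitive l x y (tau + delta) - window_primitive l x y (tau - delta)) =
  2 * delta * (x * cos (l * tau) + y * sin (l * tau)).
Proof.
move=> d0 dl; rewrite /window_primitive; have [->|l0] := eqVneq l 0.
  by rewrite mulr0 /inv_sinc eqxx !mul0r cos0 sin0; ring.
have := inv_sincK dl; rewrite -mulrBl => E.
rewrite !mulrDr !mulrN sinD cosD sinB cosB (mulrC l delta).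
rewrite [LHS](_ : _ = 2 / l * (inv_sinc (delta * l) * sin (delta * l)) *
  (x * cos (l * tau) + y * sin (l * tau))); first by rewrite E; field.
by move: (inv_sinc _) (cos (delta * l)) (sin (delta * l)) => q c s; field.
Qed.

Lemma cis_sum_re (I : Type) (s : seq I) (z : I -> R[i]) (l : I -> R) (u : R[i]) t :
  complex.Re (u * \sum_(n <- s) z n * cis (- (t * l n))) =
  \sum_(n <- s) (complex.Re (u * z n) * cos (l n * t) +
                 complex.Im (u * z n) * sin (l n * t)).
Proof.
rewrite mulr_sumr Re_sum; apply: eq_bigr => n _.
by rewrite mulrA cisE cosN sinN [t * _]mulrC [LHS]cReM /= mulrN opprK.
Qed.

(** The minorant [f] may change sign: its positive part is still below [g]. *)
Lemma le_primitive_integral (f F : R -> R) (g : R -> \bar R) (a b : R) :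
  a < b -> continuous f -> (forall x : R, is_derive x (1 : R) F (f x)) ->
  measurable_fun setT g -> (forall x, 0 <= g x)%E ->
  (forall x, (f x)%:E <= g x)%E ->
  ((F b - F a)%:E <= \int[mu]_(x in `[a, b]) g x)%E.
Proof.
move=> ab cf FE mg g0 fg.
have FF x : derivable F x 1 by exact: ex_derive.
have cF x : {for x, continuous F}.
  by apply/differentiable_continuous; rewrite -derivable1_diffP.
have -> : (F b - F a)%:E = (\int[mu]_(x in `[a, b]) (f x)%:E)%E.
  rewrite (@continuous_FTC2 R f F a b ab)//.
  - exact: continuous_subspaceT.
  - split => [x _||]; first exact: FF.
    + exact: cvg_at_right_filter (cF a).
    + exact: cvg_at_left_filter (cF b).
  - by move=> x _; rewrite derive1E derive_val.
have mf : measurable_fun setT (EFin \o f).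
  by apply/measurable_EFinP; exact: continuous_measurable_fun.
rewrite integralE.
apply: (@le_trans _ _ (\int[mu]_(x in `[a, b]) (EFin \o f)^\+ x)%E).
  by rewrite geeDl// oppe_le0 integral_ge0.
apply: ge0_le_integral => //.
- by apply: measurable_funTS; exact: measurable_funepos.
- exact: measurable_funTS.
- by move=> x _; rewrite funeposE ge_max fg g0.
Qed.

(** A convex function lies above its tangent lines: here [y ^ p], at the height
    [x]. *)
Lemma young_tangent (p x y : R) : 1 < p -> 0 <= x -> 0 <= y ->
  p * (x `^ (p - 1) * y) - (p - 1) * x `^ p <= y `^ p.
Proof.
move=> p1 x0 y0; have p0 : 0 < p by exact: lt_trans p1.
have q0 : 0 < p - 1 by rewrite subr_gt0.
have := @conjugate_powR R (x `^ (p - 1)) y (p / (p - 1)) p (powR_ge0 _ _) y0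
  (divr_gt0 p0 q0) p0.
rewrite -powRrM mulrCA divff ?gt_eqF// mulr1 invf_div => E.
have {}E : x `^ (p - 1) * y <= x `^ p * ((p - 1) / p) + y `^ p / p.
  by apply: E; rewrite -{2}[p^-1]mul1r -mulrDl subrK divff ?gt_eqF.
move: E; rewrite -(ler_pM2l p0) => /le_trans E.
rewrite lerBlDr; apply: E; rewrite mulrDr addrC.
rewrite [X in X + _](_ : _ = y `^ p); last by field; rewrite gt_eqF.
by rewrite [X in _ + X](_ : _ = (p - 1) * x `^ p)//; field; rewrite gt_eqF.
Qed.

(** A value of [P] is the window average of [Q], the polynomial [P] with its
    coefficients divided by the sinc of their frequencies; Jensen's inequality
    then compares [p]-th powers. The tangent-line form of Jensen at the height
    [cval P tau] leaves only a function with an explicit primitive to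
    integrate. *)
Lemma cval_powR_le_integral P (p delta tau : R) : 1 < p -> 0 < delta ->
  (forall n, n \in dsupp P -> 0 <= delta * ln n%:R <= 2^-1) ->
  ((2 * delta * cval P tau `^ p)%:E <=
   \int[mu]_(t in `[(tau - delta)%R, (tau + delta)%R])
     (cval (with_coef P (fun n => (dcoef P n *
        Complex (inv_sinc (delta * ln n%:R)) 0)%R)) t `^ p)%:E)%E.
Proof.
move=> p1 d0 hx; set Q := with_coef _ _; set m := cval P tau.
have m0 : 0 <= m by exact: cval_ge0.
have p0 : 0 < p by exact: lt_trans p1.
have [u u1 uE] := normc_phase (deval P (critical tau)).
pose z n := dcoef P n * Complex (expR (- (2^-1 * ln n%:R))) 0.
pose l n : R := ln n%:R; pose q n := inv_sinc (delta * l n).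
pose h n t := complex.Re (u * z n) * cos (l n * t) +
              complex.Im (u * z n) * sin (l n * t).
pose H n := window_primitive (l n) (complex.Re (u * z n)) (complex.Im (u * z n)).
pose f0 t := \sum_(n <- dsupp P) q n * h n t.
pose F0 t := \sum_(n <- dsupp P) q n * H n t.
have f0E t : complex.Re (u * deval Q (critical t)) = f0 t.
  rewrite deval_critical (cis_sum_re _ _ l); apply: eq_bigr => n _.
  rewrite (_ : u * _ = u * z n * Complex (q n) 0); last by rewrite /Q/= /z; ring.
  by rewrite /h; move: (u * z n) => [x y] /=; ring.
have dF0 t : is_derive t (1 : R) F0 (f0 t).
  rewrite /F0 /f0; elim: (dsupp P : seq nat) => [|n s ih].
    under eq_fun do rewrite big_nil.
    by rewrite big_nil; exact: is_derive_cst.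
  under eq_fun do rewrite big_cons.
  rewrite big_cons; apply: is_deriveD.
  by apply: is_deriveZ; exact: is_derive_window_primitive.
have F0d : F0 (tau + delta) - F0 (tau - delta) = 2 * delta * m.
  rewrite /F0 -sumrB /m /cval -uE deval_critical (cis_sum_re _ _ l) mulr_sumr.
  rewrite big_seq [RHS]big_seq; apply: eq_bigr => n nP.
  by rewrite -mulrBr /H window_primitive_diff// hx.
(* f is the tangent-line minorant of the p-th power of the modulus of Q *)
pose f t := p * (m `^ (p - 1) * f0 t) - (p - 1) * m `^ p.
pose F t := p * (m `^ (p - 1) * F0 t) - (p - 1) * m `^ p * t.
have -> : 2 * delta * m `^ p = F (tau + delta) - F (tau - delta).
  rewrite [RHS](_ : _ = p * m `^ (p - 1) * (F0 (tau + delta) - F0 (tau - delta)) -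
    (p - 1) * m `^ p * (2 * delta)); last by rewrite /F; ring.
  by rewrite F0d -(mulr_powRB1 m0 p0); ring.
have cf0 : continuous f0.
  apply: continuous_big => [|n _ t]; first exact: add_continuous.
  have ct (g : R -> R) : continuous g -> {for t, continuous (fun v => g (l n * v))}.
    move=> cg; apply: (@continuous_comp _ _ _ (fun v => l n * v) g); last exact: cg.
    exact: mulrl_continuous.
  apply: cvgM; first exact: cvg_cst.
  apply: cvgD; (apply: cvgM; first exact: cvg_cst).
  - exact: ct (@continuous_cos R).
  - exact: ct (@continuous_sin R).
apply: (@le_primitive_integral f F) => //.
- lra.
- move=> t; apply: cvgB; last exact: cvg_cst.
  apply: cvgM; first exact: cvg_cst.
  by apply: cvgM; [exact: cvg_cst | exact: cf0].
- move=> t.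
  have -> : F = (p * m `^ (p - 1)) *: F0 - ((p - 1) * m `^ p) *: id.
    by apply/funext => v; rewrite /F mulrA.
  apply: is_derive_eq.
  by rewrite /GRing.scale /= /f mulr1 mulrA.
- exact: measurable_cval_powR.
- by move=> t; rewrite lee_fin powR_ge0.
- move=> t; rewrite lee_fin; apply: le_trans (young_tangent p1 m0 (cval_ge0 Q t)).
  rewrite lerD2r ler_pM2l// ler_wpM2l ?powR_ge0// -f0E.
  by rewrite (le_trans (Re_le_normc _))// normcM u1 mul1r.
Qed.

End sampling.

(** * Local embedding and sampling *)

Section local_embedding_and_sampling.
Context {R : realType}.
Variables (p : R) (p1 : 1 < p).
Implicit Types (P : @dirichlet_poly R) (T : {fset R}).
Local Notation mu := (@lebesgue_measure R).

Let p0 : 0 < p. Proof. exact: lt_trans p1. Qed.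
Let p1W : 1 <= p. Proof. exact: ltW. Qed.

Lemma hardy_norm_poweR P :
  (hardy_norm p P `^ p = (hpnorm p P `^ p)%:E)%E.
Proof. by rewrite hpnormE// poweR_EFin. Qed.

Lemma LEP_bound : LEP p -> exists2 C : R, 0 <= C & forall P (a : R),
  (\int[mu]_(t in `[a, (a + 1)%R]) (cval P t `^ p)%:E
   <= (C * hpnorm p P `^ p)%:E)%E.
Proof.
move=> [C CP]; exists `|C| => // P a.
apply: (@le_trans _ _ (C%:E * hardy_norm p P `^ p)%E).
  by apply: le_trans (CP P); apply: ereal_sup_ubound; exists a.
rewrite hardy_norm_poweR -EFinM lee_fin ler_wpM2r ?powR_ge0//.
exact: ler_norm.
Qed.

(** Disjoint windows centred in an interval of length one fit in the union of
    that interval and its two neighbours. *)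
Lemma sum_windows_le (g : R -> \bar R) T (a delta : R) :
  measurable_fun setT g -> (forall x, 0 <= g x)%E ->
  0 < delta <= 1 -> (forall t, t \in T -> a <= t <= a + 1) ->
  (forall t u, t \in T -> u \in T -> t != u -> 2 * delta <= `|t - u|) ->
  (\sum_(t <- T) \int[mu]_(x in `[(t - delta)%R, (t + delta)%R]) g x <=
   \int[mu]_(x in `[(a - 1)%R, a]) g x + \int[mu]_(x in `[a, (a + 1)%R]) g x +
   \int[mu]_(x in `[(a + 1)%R, (a + 1 + 1)%R]) g x)%E.
Proof.
move=> mg g0 /andP[d0 d1] Ta Tsep.
rewrite -addeA -ge0_integral_split_closed//; [|lra..].
rewrite -ge0_integral_split_closed//; [|lra..].
rewrite -integral_itv_bndo_bndc; last exact: measurable_funTS.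
under eq_bigr => t _.
  rewrite -integral_itv_bndo_bndc; last exact: measurable_funTS.
  over.
rewrite -(@ge0_integral_bigsetU _ _ _ mu _ (fun t : R => `[t - delta, t + delta[%classic))//.
- apply: ge0_subset_integral => //.
  + exact: bigsetU_measurable.
  + exact: measurable_funTS.
  + move=> x; rewrite -bigcup_seq => -[t /= tT]; rewrite !in_itv/=.
    by have := Ta _ tT; lra.
- exact: fset_uniq.
- apply/trivIsetP => t u /= tT uT tu; apply/seteqP; split => // x [] /=.
  rewrite !in_itv/= => /andP[xt1 xt2] /andP[xu1 xu2].
  have := Tsep _ _ tT uT tu; rewrite leNgt => /negP; apply.
  by rewrite ltr_norml; apply/andP; split; lra.
- exact: measurable_funTS.
Qed.

Lemma logX_ge (X : nat) : (3 <= X)%N -> 2 / 3 <= logX X :> R.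
Proof.
move=> X3; rewrite /logX (@le_trans _ _ (ln 3))//.
  have := @le_ln1Dx R (- (2 / 3)); rewrite (_ : 1 + _ = 3^-1); last by field.
  by rewrite lnV ?posrE// => H; have := H ltac:(lra); lra.
by rewrite ler_ln ?posrE ?ltr0n ?ler_nat// (leq_trans _ X3).
Qed.

Lemma ln_dirichlet_upto (X n : nat) P : dirichlet_upto X P -> n \in dsupp P ->
  0 <= (ln n%:R : R) <= logX X.
Proof.
move=> PX /PX /andP[n0 nX]; rewrite ln_ge0 ?ler1n//=.
by rewrite ler_ln ?posrE ?ltr0n ?ler_nat ?(ltn_trans n0 nX)// ltnW.
Qed.

(** Three unit intervals contribute the factor [3 C], the passage from [P] to
    [Q] the factor [2 ^ p], and the window width [c / logX X] the division by
    [c]. *)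
Lemma LEP_CAS (c : R) : 0 < c <= 1 -> LEP p -> CAS p c.
Proof.
move=> /andP[c0 c1] /LEP_bound[C C0 CP].
exists ((3 * C * 2 `^ p / c) `^ p^-1) => X T [X3 [a Ta] Tsep] P PX.
have L0 : 2 / 3 <= logX X :> R by exact: logX_ge.
have Lgt0 : 0 < logX X :> R by lra.
(* half the separation: windows are disjoint, and delta ln n <= c / 2 <= 1 / 2 *)
pose delta : R := c / (2 * logX X).
have d0 : 0 < delta by rewrite divr_gt0// mulr_gt0.
have d2 : 2 * delta = c / logX X by rewrite /delta; field; rewrite gt_eqF.
have d1 : delta <= 1 by rewrite ler_pdivrMr ?mulr_gt0//; lra.
have hx n : n \in dsupp P -> 0 <= delta * ln n%:R <= 2^-1.
  move=> /(ln_dirichlet_upto PX)/andP[l0 lL].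
  rewrite mulr_ge0 ?(ltW d0)//= (le_trans (ler_wpM2l (ltW d0) lL))//.
  by rewrite (_ : delta * _ = c / 2) ?ler_pdivrMr//; [lra|rewrite /delta; field; rewrite gt_eqF].
set Q := with_coef P (fun n => dcoef P n * Complex (inv_sinc (delta * ln n%:R)) 0).
have hQ : hpnorm p Q <= 2 * hpnorm p P by exact: hpnorm_inv_sinc.
have S : 2 * delta * \sum_(t <- T) cval P t `^ p <= 3 * C * 2 `^ p * hpnorm p P `^ p.
  rewrite -lee_fin mulr_sumr -sumEFin.
  apply: (@le_trans _ _ (\sum_(t <- T)
    \int[mu]_(x in `[(t - delta)%R, (t + delta)%R]) (cval Q x `^ p)%:E)%E).
    by apply: lee_sum => t _; exact: cval_powR_le_integral.
  apply: (@le_trans _ _ _ _ _ (sum_windows_le (a := a) _ _ _ _ _)) => //.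
  - exact: measurable_cval_powR.
  - by move=> x; rewrite lee_fin powR_ge0.
  - by rewrite d0 d1.
  - by move=> t u tT uT tu; rewrite d2; exact: Tsep.
  have H b : (\int[mu]_(t in `[b, (b + 1)%R]) (cval Q t `^ p)%:E
     <= (C * 2 `^ p * hpnorm p P `^ p)%:E)%E.
    rewrite (le_trans (CP Q b))// lee_fin -mulrA ler_wpM2l//.
    rewrite -powRM ?hpnorm_ge0//; apply: ge0_ler_powR; rewrite ?nnegrE ?hpnorm_ge0 ?mulr_ge0 ?hpnorm_ge0// ltW//.
  rewrite (_ : 3 * C * _ * _ = C * 2 `^ p * hpnorm p P `^ p +
     C * 2 `^ p * hpnorm p P `^ p + C * 2 `^ p * hpnorm p P `^ p); last by ring.
  rewrite !EFinD; apply: leeD; [apply: leeD|] => //.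
  by have := H (a - 1); rewrite subrK.
rewrite hpnormE// -EFinM lee_fin.
have -> : hpnorm p P = (hpnorm p P `^ p) `^ p^-1.
  by rewrite -powRrM divff ?gt_eqF// powRr1// hpnorm_ge0.
rewrite -powRM ?powR_ge0 ?mulr_ge0 ?divr_ge0 ?powR_ge0 ?(ltW c0)//.
apply: ge0_ler_powR; rewrite ?nnegrE ?invr_ge0 ?(ltW p0)//.
- by rewrite mulr_ge0 ?invr_ge0 ?(ltW Lgt0)// sumr_ge0// => t _; exact: powR_ge0.
- by rewrite !mulr_ge0 ?invr_ge0 ?powR_ge0 ?(ltW c0).
have -> : (logX X)^-1 = 2 * delta / c by rewrite d2; field; rewrite !gt_eqF.
rewrite mulrAC ler_pdivrMr// (le_trans S)//.
by rewrite le_eqVlt; apply/orP; left; apply/eqP; field; rewrite gt_eqF.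
by rewrite invr_ge0 ltW.
Qed.

Lemma CAS_bound (c : R) : CAS p c -> exists2 A : R, 0 <= A & forall X T,
  admissible c X T -> forall P, dirichlet_upto X P ->
  ((logX X)^-1 * \sum_(t <- T) cval P t `^ p) `^ p^-1 <= A * hpnorm p P.
Proof.
move=> [A AP]; exists `|A| => // X T XT P PX.
have := AP X T XT P PX; rewrite hpnormE// -EFinM lee_fin => /le_trans; apply.
by rewrite ler_wpM2r ?hpnorm_ge0// ler_norm.
Qed.

Lemma logX_gt0 (X : nat) : (3 <= X)%N -> 0 < logX X :> R.
Proof. by move=> /logX_ge; apply: lt_le_trans; lra. Qed.

Lemma ge0_integral_equal_pieces (g : R -> \bar R) (a h : R) N :
  measurable_fun setT g -> (forall x, 0 <= g x)%E -> 0 <= h ->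
  (\int[mu]_(x in `[a, (a + h *+ N)%R]) g x =
   \int[mu]_(x in `[0%R, h]) \sum_(k < N) g (x + (a + h *+ k))%R)%E.
Proof.
move=> mg g0 h0; rewrite ge0_integral_sum//; last first.
  move=> k; apply: measurable_funTS; apply: (measurableT_comp mg).
  exact: measurable_funD.
elim: N => [|N ih].
  by rewrite big_ord0 mulr0n addr0 set_itv1 integral_set1.
rewrite (@ge0_integral_split_closed _ a (a + h *+ N))//.
- rewrite big_ord_recr /= ih; congr (_ + _)%E.
  rewrite -[LHS](@ge0_integral_shift _ (a + h *+ N))//.
  have -> : [set x : R | `[a + h *+ N, a + h *+ N.+1]%classic (x + (a + h *+ N))] =
      `[0, h]%classic => [|//].
    by apply/seteqP; split => x /=; rewrite !in_itv/= mulrSr; lra.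
- by rewrite lerDl mulrn_wge0.
- by rewrite mulrSr; lra.
Qed.

(** Rounding [logX X / c] down to an integer keeps the translates separated by
    [c / logX X], and costs at most a factor two. *)
Lemma CAS_LEP (c : R) : 0 < c <= 1 -> CAS p c -> LEP p.
Proof.
move=> /andP[c0 c1] /CAS_bound[A A0 AP]; exists (2 * A `^ p) => P.
(* with X >= 8 one has log X >= 1 >= c, so at least one piece *)
pose X := maxn 8 (\max_(n <- dsupp P) n).+1.
have X3 : (3 <= X)%N by rewrite leq_max.
have PX : dirichlet_upto X P.
  move=> n nP; rewrite (dsupp_gt0 nP) leq_max.
  by rewrite [X in _ || X]ltnS le_max_dsupp// orbT.
have L1 : 1 <= logX X :> R.
  rewrite /logX (@le_trans _ _ (ln (2 ^+ 3)))//.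
    have := @le_ln1Dx R (- 2^-1); rewrite (_ : 1 + _ = 2^-1); last by field.
    rewrite lnV ?posrE// => H; have {}H := H ltac:(lra).
    by rewrite lnXn// -[_ *+ 3]mulr_natl; lra.
  by rewrite -natrX ler_ln ?posrE ?ltr0n ?ler_nat ?leq_max.
have L0 : 0 < logX X :> R by lra.
have Lc : 1 <= logX X / c by rewrite ler_pdivlMr//; lra.
pose N := Num.truncn (logX X / c).
have /andP[NL LN] : N%:R <= logX X / c < N.+1%:R by apply: truncn_itv; lra.
have N0 : (0 < N)%N by rewrite /N truncn_gt0.
have N0R : 0 < N%:R :> R by rewrite ltr0n.
pose h : R := N%:R^-1.
have h0 : 0 < h by rewrite invr_gt0.
have hN : h *+ N = 1 by rewrite -mulr_natr mulVf ?gt_eqF.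
have ch : c / logX X <= h.
  by rewrite ler_pdivrMr// mulrC ler_pdivlMr// mulrC -ler_pdivlMr.
have hL : h * logX X <= 2.
  rewrite mulrC ler_pdivrMr//.
  move: LN; rewrite ltr_pdivrMr// => /ltW/le_trans; apply.
  rewrite (@le_trans _ _ (N.+1%:R * 1)) ?ler_wpM2l// mulr1 -natrM ler_nat.
  by rewrite mul2n -addnn -addn1 leq_add2l.
rewrite hardy_norm_poweR -EFinM.
apply: ub_ereal_sup => _ [theta _ <-].
rewrite -[X in (theta + X)%R]hN.
rewrite (@ge0_integral_equal_pieces (fun t => (cval P t `^ p)%:E))//; last 3 first.
- exact: measurable_cval_powR.
- by move=> x; rewrite lee_fin powR_ge0.
- exact: ltW.
pose K := logX X * (A * hpnorm p P) `^ p.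
apply: (@le_trans _ _ (\int[mu]_(x in `[0%R, h]) (K%:E))%E).
  apply: ge0_le_integral => //.
  - by move=> x _; apply: sume_ge0 => k _; rewrite lee_fin powR_ge0.
  - apply: emeasurable_sum => k; apply: measurable_funTS.
    apply: (measurableT_comp (measurable_cval_powR P p)).
    exact: measurable_funD.
  move=> x /=; rewrite in_itv/= => /andP[x0 xh].
  rewrite sumEFin lee_fin /K -ler_pdivrMl//.
  pose s := [seq x + (theta + h *+ k) | k <- iota 0 N].
  pose T := [fset t | t in s]%fset.
  have us : uniq s.
    rewrite map_inj_in_uniq ?iota_uniq// => i j _ _ /addrI/addrI.
    rewrite -!(mulr_natr h) => /(mulfI (lt0r_neq0 h0))/eqP.
    by rewrite eqr_nat => /eqP.
  have Ts : perm_eq T s.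
    by apply: uniq_perm; [exact: fset_uniq | exact: us | move=> t; rewrite !inE].
  have := AP X T _ P PX; rewrite (perm_big _ Ts) /= big_map -/(iota 0 N).
  have -> : \sum_(k <- iota 0 N) cval P (x + (theta + h *+ k)) `^ p =
     \sum_(k < N) cval P (x + (theta + h *+ k)) `^ p.
    by rewrite -[X in iota 0 X]subn0 big_mkord.
  move=> H; have {}H : admissible c X T -> _ := H.
  have hmono (i j : nat) : (i <= j)%N -> h *+ i <= h *+ j.
    by move=> ij; rewrite -!(mulr_natr h) ler_pM2l// ler_nat.
  have {}/H H : admissible c X T.
    split=> //.
    + exists theta => t; rewrite !inE => /mapP[k]; rewrite mem_iota add0n => /andP[_ kN] ->.
      have kh0 : 0 <= h *+ k by rewrite mulrn_wge0// ltW.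
      have : h *+ k.+1 <= h *+ N by exact: hmono.
      by rewrite mulrSr hN; lra.
    + have sep (i j : nat) : (i < j)%N -> h <= h *+ j - h *+ i.
        by move=> ij; rewrite -mulrnBr ?(ltnW ij)// -{1}[h]mulr1n hmono// subn_gt0.
      move=> t u; rewrite !inE => /mapP[i _ ->] /mapP[j _ ->] tu.
      apply: (le_trans ch); case: (ltngtP i j) => ij.
      * rewrite distrC ler_normr; apply/orP; left.
        by have := sep _ _ ij; lra.
      * rewrite ler_normr; apply/orP; left.
        by have := sep _ _ ij; lra.
      * by rewrite ij eqxx in tu.
  set W := (X in X <= _); set V := (X in (X `^ _ <= _)) in H.
  have W0 : 0 <= W.
    by rewrite mulr_ge0 ?invr_ge0 ?(ltW L0)// sumr_ge0// => k _; exact: powR_ge0.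
  rewrite -[W]powRr1// -(mulVf (lt0r_neq0 p0)) powRrM.
  apply: ge0_ler_powR; rewrite ?nnegrE ?(ltW p0) ?powR_ge0//.
  by rewrite mulr_ge0// hpnorm_ge0.
rewrite integral_cst//= lebesgue_measure_itv /= lte_fin h0 oppr0 adde0.
rewrite -EFinM lee_fin /K powRM ?hpnorm_ge0// mulrC (mulrA h) -[leRHS]mulrA.
by rewrite ler_wpM2r ?mulr_ge0 ?powR_ge0.
Qed.

End local_embedding_and_sampling.

(** * Duality *)

Section duality.
Context {R : realType}.
Variables (p : R) (p1 : 1 < p).
Implicit Types (P : @dirichlet_poly R) (T : {fset R}).

Let p0 : 0 < p. Proof. exact: lt_trans p1. Qed.
Let q := p / (p - 1).
Let q0 : 0 < q. Proof. by rewrite divr_gt0// subr_gt0. Qed.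
Let pq : p^-1 + q^-1 = 1.
Proof. by rewrite /q invf_div -{1}[p^-1]mul1r -mulrDl addrC subrK divff ?gt_eqF. Qed.

Lemma powR_invV (x r : R) : 0 <= x -> r != 0 -> (x `^ r^-1)^-1 `^ r = x^-1.
Proof. by move=> x0 r0; rewrite -powRN -powRrM mulNr mulVf// powRN powRr1. Qed.

(** Young's inequality for the normalized families. *)
Lemma hoelder_sum (I : eqType) (s : seq I) (x y : I -> R) :
  (forall i, 0 <= x i) -> (forall i, 0 <= y i) ->
  \sum_(i <- s) x i * y i <=
  (\sum_(i <- s) x i `^ p) `^ p^-1 * (\sum_(i <- s) y i `^ q) `^ q^-1.
Proof.
move=> x0 y0; set S := \sum_(i <- s) x i `^ p; set T := \sum_(i <- s) y i `^ q.
have null (r : R) (f : I -> R) : 0 < r -> (forall i, 0 <= f i) ->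
    \sum_(i <- s) f i `^ r = 0 -> {in s, forall i, f i = 0}.
  move=> r0 f0 /eqP; rewrite psumr_eq0 => [|i _]; last exact: powR_ge0.
  move=> /allP f00 i /f00 /=; rewrite powR_eq0 => /andP[/eqP//].
have S0 : 0 <= S by rewrite sumr_ge0// => i _; exact: powR_ge0.
have T0 : 0 <= T by rewrite sumr_ge0// => i _; exact: powR_ge0.
have [Sz|Snz] := eqVneq S 0.
  rewrite big_seq big1 ?mulr_ge0 ?powR_ge0// => i si.
  by rewrite (null p x p0 x0 Sz i si) mul0r.
have [Tz|Tnz] := eqVneq T 0.
  rewrite big_seq big1 ?mulr_ge0 ?powR_ge0// => i si.
  by rewrite (null q y q0 y0 Tz i si) mulr0.
have Spos : 0 < S by rewrite lt_neqAle eq_sym Snz.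
have Tpos : 0 < T by rewrite lt_neqAle eq_sym Tnz.
set a := S `^ p^-1; set b := T `^ q^-1.
have a0 : 0 < a by rewrite powR_gt0.
have b0 : 0 < b by rewrite powR_gt0.
have aS : a^-1 `^ p = S^-1 by rewrite powR_invV ?gt_eqF.
have bT : b^-1 `^ q = T^-1 by rewrite powR_invV ?gt_eqF.
clearbody a b.
have -> : \sum_(i <- s) x i * y i = a * b * \sum_(i <- s) x i / a * (y i / b).
  by rewrite mulr_sumr; apply: eq_bigr => i _; field; rewrite !gt_eqF.
rewrite -[leRHS]mulr1 ler_wpM2l ?mulr_ge0 ?(ltW a0) ?(ltW b0)//.
apply: (@le_trans _ _ (\sum_(i <- s) (x i `^ p / (S * p) + y i `^ q / (T * q)))).
  apply: ler_sum => i _.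
  have := conjugate_powR (divr_ge0 (x0 i) (ltW a0)) (divr_ge0 (y0 i) (ltW b0)) p0 q0 pq.
  rewrite !powRM ?invr_ge0 ?(ltW a0) ?(ltW b0)//.
  rewrite aS bT => H.
  by rewrite (le_trans H)// !invfM !mulrA.
rewrite big_split /= -!mulr_suml -/S -/T (invfM S) (invfM T) !mulrA.
by rewrite !divff// !mul1r pq.
Qed.

Lemma CAS_DCP (c : R) : CAS p c -> DCP p c.
Proof.
move=> /(CAS_bound p1)[A A0 AP]; exists A => X T XT b.
have [X3 _ _] := XT.
have L0 := @logX_gt0 R X X3.
apply: ub_ereal_sup => _ [P [PX /= hP] <-]; rewrite lee_fin -/q.
have {}hP : hpnorm p P <= 1 by rewrite -lee_fin -hpnormE// ltW.
rewrite normcM normc_real ger0_norm ?powR_ge0//.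
apply: (@le_trans _ _ (logX X `^ (- p^-1) *
   \sum_(t <- T) cval P t * normc (b t))).
  rewrite ler_wpM2l ?powR_ge0// (le_trans (normc_sum _ _))// ler_sum// => t _.
  by rewrite normcM mulrC.
apply: (@le_trans _ _ (logX X `^ (- p^-1) * ((\sum_(t <- T) cval P t `^ p) `^ p^-1 *
   (\sum_(t <- T) normc (b t) `^ q) `^ q^-1))).
  rewrite ler_wpM2l ?powR_ge0//; apply: hoelder_sum => t; exact: normc_ge0.
rewrite mulrA ler_wpM2r ?powR_ge0//.
have := AP X T XT P PX.
rewrite powRM ?invr_ge0 ?(ltW L0)//; last first.
  by apply: sumr_ge0 => t _; exact: powR_ge0.
rewrite -powR_inv1 ?(ltW L0)// -powRrM mulN1r => /le_trans; apply.
by rewrite -{2}[A]mulr1 ler_wpM2l.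
Qed.

Lemma deval_with_coefZ P (k : R[i]) t :
  deval (with_coef P (fun n => k * dcoef P n)) t = k * deval P t.
Proof. by rewrite /deval mulr_sumr; apply: eq_bigr => n _; rewrite mulrA. Qed.

(** The dual property is tested against the extremal vector of Hoelder's
    inequality, [conj (P t) |P t| ^ (p - 2)], written as a phase times
    [|P t| ^ (p - 1)] so that zeros of [P] need no care. *)
Lemma DCP_CAS (c : R) : DCP p c -> CAS p c.
Proof.
move=> [B BP]; exists `|B| => X T XT P PX.
have [X3 _ _] := XT; have L0 := @logX_gt0 R X X3.
rewrite hpnormE ?(ltW p1)// -EFinM lee_fin.
set S := \sum_(t <- T) _.
have S0 : 0 <= S by apply: sumr_ge0 => t _; exact: powR_ge0.
have [->|Snz] := eqVneq S 0.
  by rewrite mulr0 powR0 ?invr_eq0 ?gt_eqF// mulr_ge0 ?hpnorm_ge0// ltW.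
have Spos : 0 < S by rewrite lt_neqAle eq_sym Snz.
pose m t := cval P t.
pose u t := sval (cid2 (normc_phase (deval P (critical t)))).
have u1 t : normc (u t) = 1 by rewrite /u; case: cid2.
have uE t : complex.Re (u t * deval P (critical t)) = m t.
  by rewrite /u; case: cid2.
pose b t := u t * Complex (m t `^ (p - 1)) 0.
have bq : \sum_(t <- T) normc (b t) `^ q = S.
  apply: eq_bigr => t _; rewrite /b normcM u1 mul1r normc_real.
  by rewrite ger0_norm ?powR_ge0// -powRrM /q mulrCA divff ?mulr1// gt_eqF// subr_gt0.
set W := _ `^ _.
have WE : W = logX X `^ (- p^-1) * S `^ p^-1.
  rewrite /W powRM ?invr_ge0 ?(ltW L0)// -powR_inv1 ?(ltW L0)//.
  by rewrite -powRrM mulN1r.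
have W0 : 0 < W by rewrite WE mulr_gt0 ?powR_gt0.
(* testing with all multiples k P of norm at most one, instead of normalizing P,
   also covers the case of norm zero *)
have key (k : R) : 0 <= k -> k * hpnorm p P <= 1 -> k * W <= `|B|.
  move=> k0 kh; pose Q := with_coef P (fun n => Complex k 0 * dcoef P n).
  have QX : dirichlet_upto X Q by exact: PX.
  have hQ : (hardy_norm p Q <= 1)%E.
    rewrite hpnormE ?(ltW p1)// lee_fin hpnormZ ?(ltW p1)// with_coefE normc_real.
    by rewrite ger0_norm.
  have := BP X T XT b; rewrite -/q bq => H.
  have {}H : normc (Complex (logX X `^ (- p^-1)) 0 *
      \sum_(t <- T) b t * deval Q (critical t)) <= B * S `^ q^-1.
    by rewrite -lee_fin; apply: le_trans H; apply: ereal_sup_ubound; exists Q.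
  have {}H : k * W * S `^ q^-1 <= B * S `^ q^-1.
    apply: le_trans H; rewrite normcM normc_real ger0_norm ?powR_ge0//.
    rewrite WE mulrA -(mulrA _ (S `^ _)) -powRD ?pq ?powRr1//; last by rewrite oner_eq0.
    rewrite [k * _]mulrC -mulrA ler_wpM2l ?powR_ge0//.
    apply: le_trans (Re_le_normc _); rewrite Re_sum /S mulr_sumr.
    rewrite le_eqVlt; apply/orP; left; apply/eqP; apply: eq_bigr => t _.
    rewrite deval_with_coefZ /b -(mulr_powRB1 (cval_ge0 P t) p0) -/(m t) -uE.
    by move: (u t) (deval P _) => [x1 x2] [y1 y2] /=; ring.
  by move: H; rewrite ler_pM2r ?powR_gt0// => /le_trans; apply; exact: ler_norm.
have [hz|hnz] := eqVneq (hpnorm p P) 0.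
  have := key ((`|B| + 1) / W); rewrite hz mulr0 divfK ?gt_eqF// => H.
  have k0 : 0 <= (`|B| + 1) / W by rewrite divr_ge0 ?addr_ge0// ltW.
  by have {H} := H k0 ler01; lra.
have hpos : 0 < hpnorm p P by rewrite lt_neqAle eq_sym hnz hpnorm_ge0 ?(ltW p1).
have := key (hpnorm p P)^-1.
rewrite mulVf// invr_ge0 (ltW hpos) lexx => /(_ isT isT).
by rewrite ler_pdivrMl// mulrC.
Qed.

End duality.

Theorem theorem10p6 (R : realType) (p : R) (hp : 1 < p) :
  (forall c : R, 0 < c <= 1 -> (LEP p <-> CAS p c) /\ (CAS p c <-> DCP p c)) /\
  (LEP p -> forall c : R, 0 < c <= 1 -> CAS p c) /\
  ((exists c : R, 0 < c <= 1 /\ CAS p c) -> LEP p).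
Proof.
split=> [c c01|]; last split.
- split; split.
  + exact: LEP_CAS.
  + exact: (CAS_LEP hp c01).
  + exact: CAS_DCP.
  + exact: DCP_CAS.
- by move=> lep c c01; exact: LEP_CAS.
- by move=> [c [c01 cas]]; exact: (CAS_LEP hp c01 cas).
Qed.
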